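(* Let $n\ge 2$, $\lambda=(\lambda_1,\dots,\lambda_n)\in\mathfrak h^*$, $\sigma\in S_n$, and $\bar\lambda=\lambda+(0,-1,-2,\dots,-n+1)$. If the graph $G=G(T_\sigma(\bar\lambda))$ is a relation graph, then the tableau $T_\sigma(\bar\lambda)$, viewed as a vector of the $\mathfrak{gl}_n$-module $V_G(T_\sigma(\bar\lambda))$, is a highest weight vector of weight $\lambda$ with respect to the triangular decomposition of $\mathfrak{gl}_n$ induced by $\sigma(\mathfrak h)$; that is, $E_{\sigma(i)\sigma(i)}T_\sigma(\bar\lambda)=\lambda_i T_\sigma(\bar\lambda)$ for $1\le i\le n$ and $E_{\sigma(i)\sigma(j)}T_\sigma(\bar\lambda)=0$ for $1\le i<j\le n$. In particular, $V_G(T_\sigma(\bar\lambda))$ is a highest weight module of highest weight $\lambda$ with respect to $\sigma(\mathfrak h)$ (i.e. with respect to this triangular decomposition).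
   Context: $\mathfrak h$ is the standard (diagonal) Cartan subalgebra of $\mathfrak{gl}_n(\mathbb C)$, $E_{ij}$ are the matrix units, and $\lambda\in\mathfrak h^*$ is identified with $(\lambda_1,\dots,\lambda_n)\in\mathbb C^n$, $\lambda_i=\lambda(E_{ii})$. **Graphs $G_\sigma$.** Let $\mathfrak V=\{(i,j): 1\le j\le i\le n\}$; $(k,1),\dots,(k,k)$ form row $k$, row $n$ being the top row. $\Sigma$ is the set of directed graphs on $\mathfrak V$ having, for each $1\le s<r\le n$, exactly one of the arrows $(r,s)\to(r-1,s)$ (then $A_{(r,s)}(G)=1$) or $(r-1,s)\to(r,s)$ (then $A_{(r,s)}(G)=-1$), and no other arrows. Let $\alpha_{ij}=\varepsilon_i-\varepsilon_j$ ($i\ne j$), $\Delta^+=\{\alpha_{ij}: i<j\}$, $\sigma(\alpha_{ij})=\alpha_{\sigma(i)\sigma(j)}$, and for $G\in\Sigma$ put $\mathcal Q_G=\{\alpha_{ij}: i<j, A_{(j,i)}(G)=1\}\cup\{\alpha_{ji}: i<j, A_{(j,i)}(G)=-1\}$. $G_\sigma$ is the unique element of $\Sigma$ with $\mathcal Q_{G_\sigma}=\sigma(\Delta^+)$. **Tableaux.** A Gelfand-Tsetlin tableau $T(L)$ is a triangular array of complex numbers $l_{ij}$ indexed by $(i,j)\in\mathfrak V$. For $X\in\mathbb C^n$, $T_\sigma(X)=T(Y)$ is defined by $y_{n,i}=x_{\sigma^{-1}(i)}$ and, recursively for $k=n,\dots,2$ and $1\le i\le k-1$, $y_{k-1,i}=y_{k,i}$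 if $G_\sigma$ has an arrow $(k,i)\to(k-1,i)$, and $y_{k-1,i}=y_{k,i}+1$ if $G_\sigma$ has an arrow $(k-1,i)\to(k,i)$. **Relation graphs.** All graphs are directed graphs on $\mathfrak V$ whose arrows connect only vertices in consecutive rows or vertices of row $n$, without oriented cycles or multiple arrows. $G$ is non-critical if any two vertices in the same row $k<n$ lying in the same connected component of the underlying unoriented graph are joined by an oriented path from one to the other. $T(L)$ satisfies $G$ if for each arrow $(i,j)\to(r,s)$ one has $l_{ij}-l_{rs}\in\mathbb Z_{\ge0}$ when the arrow is horizontal or points down ($r=i-1$), and $l_{ij}-l_{rs}\in\mathbb Z_{>0}$ when it points up ($r=i+1$). $T(L)$ is a $G$-realization if it satisfies $G$ and, for all $1\le k\le n-1$, $l_{ki}-l_{kj}\in\mathbb Z$ only if $(k,i),(k,j)$ are in the same connected component. For a $G$-realization $T(L)$, $V_G(T(L))$ is the complex vector space with basis all $G$-realizations $T(L+z)$, $z$ an integer array with $z_{ni}=0$ for all $i$. A non-critical $G$ is a relation graph if for every $G$-realization $T(L)$ the Gelfand-Tsetlin formulas $$E_{k,k+1}T(L)=-\sum_{i=1}^k\frac{\prod_{j=1}^{k+1}(l_{ki}-l_{k+1,j})}{\prod_{j\ne i}(l_{ki}-l_{kj})}T(L+\delta^{ki}),\quad E_{k+1,k}T(L)=\sum_{i=1}^k\frac{\prod_{j=1}^{k-1}(l_{ki}-l_{k-1,j})}{\prod_{j\ne i}(l_{ki}-l_{kj})}T(L-\delta^{ki}),$$ $$E_{kk}T(L)=\Big(k-1+\sum_{i=1}^kl_{ki}-\sum_{i=1}^{k-1}l_{k-1,i}\Big)T(L)$$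 define a $\mathfrak{gl}_n$-module structure on $V_G(T(L))$; here $T(L\pm\delta^{ki})$ is $T(L)$ with $\pm1$ added to entry $(k,i)$, and a summand is $0$ by definition if the new tableau is not a $G$-realization. **Graph of a tableau.** $G(T(L))$ is the transitive reduction (same reachability, minimal set of arrows) of the graph on $\mathfrak V$ with an arrow $(i,j)\to(r,s)$ if: (i) $i=r+1$ and $l_{ij}-l_{rs}\in\mathbb Z_{\ge0}$; or (ii) $i=r-1$ and $l_{ij}-l_{rs}\in\mathbb Z_{>0}$; or (iii) $i=r=n$, $j\neq s$, and $l_{nj}-l_{ns}\in\mathbb Z_{\ge0}$, where if $l_{nj}=l_{ns}$ only the arrow from the smaller to the larger index is taken. *)

(* Defs.v *)
From HB Require Import structures.
From mathcomp Require Import all_boot all_order all_algebra all_fingroup.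
From mathcomp Require Import boolp reals.
From mathcomp Require Import complex monalg.

Set Implicit Arguments.
Unset Strict Implicit.
Unset Printing Implicit Defensive.

Import Order.TTheory GRing.Theory Num.Theory.

Local Open Scope ring_scope.

(* All indices are shifted by one with respect to the mathematical text: rows *)
(* and columns are numbered 0, ..., n - 1, row r has r + 1 vertices, and the  *)
(* top row is row n - 1.                                                      *)

Notation vertex n := {p : 'I_n * 'I_n | (p.2 <= p.1)%N}.

Definition vrow (n : nat) (v : vertex n) : 'I_n := (val v).1.
Definition vcol (n : nat) (v : vertex n) : 'I_n := (val v).2.
Definition is_top (n : nat) (v : vertex n) : bool := (vrow v).+1 == n.

Notation graph n := {set vertex n * vertex n}.

Definition arrow (n : nat) (G : graph n) : rel (vertex n) :=
  fun u v => (u, v) \in G.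

Definition reach (n : nat) (G : graph n) : rel (vertex n) := connect (arrow G).

Definition same_component (n : nat) (G : graph n) : rel (vertex n) :=
  connect [rel u v | arrow G u v || arrow G v u].

(* has_arrow G (i, j) (r, s): there is an arrow from the vertex in row i and   *)
(* column j to the vertex in row r and column s (in particular these exist).   *)
Definition has_arrow (n : nat) (G : graph n) (p q : nat * nat) : bool :=
  [exists e in G, [&& nat_of_ord (vrow e.1) == p.1, nat_of_ord (vcol e.1) == p.2,
                      nat_of_ord (vrow e.2) == q.1 & nat_of_ord (vcol e.2) == q.2]].

Section Sigma.
Variable n : nat.

Definition arrow_down (G : graph n) (r s : nat) : bool :=  (* A_(r,s) = 1 *)
  has_arrow G (r, s) (r.-1, s).
Definition arrow_up (G : graph n) (r s : nat) : bool :=    (* A_(r,s) = -1 *)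
  has_arrow G (r.-1, s) (r, s).

Definition Sigma : {set graph n} :=
  [set G : graph n |
     [forall r : 'I_n, forall s : 'I_n,
        (s < r)%N ==> (arrow_down G r s (+) arrow_up G r s)]
  && [forall e in G, (vcol e.1 == vcol e.2) &&
        ((vrow e.1 == (vrow e.2).+1 :> nat) || (vrow e.2 == (vrow e.1).+1 :> nat))]].

(* The root alpha_{ij} = epsilon_i - epsilon_j is encoded by the pair (i, j). *)
Definition posroots : {set 'I_n * 'I_n} := [set a : 'I_n * 'I_n | (a.1 < a.2)%N].

Definition perm_roots (s : 'S_n) (A : {set 'I_n * 'I_n}) : {set 'I_n * 'I_n} :=
  [set (s a.1, s a.2) | a in A].

Definition Qroots (G : graph n) : {set 'I_n * 'I_n} :=
  [set a : 'I_n * 'I_n | (a.1 < a.2)%N && arrow_down G a.2 a.1]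
  :|: [set a : 'I_n * 'I_n | (a.2 < a.1)%N && arrow_up G a.1 a.2].

(* The default value set0 is never used, see GsigmaP and Gsigma_unique. *)
Definition Gsigma (s : 'S_n) : graph n :=
  odflt set0 [pick G in Sigma | Qroots G == perm_roots s posroots].

End Sigma.

Definition is_nonneg_int (R : realType) (x : R[i]) : Prop :=
  exists m : nat, x = m%:R.
Definition is_pos_int (R : realType) (x : R[i]) : Prop :=
  exists m : nat, x = m.+1%:R.
Definition is_int (R : realType) (x : R[i]) : Prop :=
  exists m : int, x = m%:~R.

Notation tableau R n := {ffun vertex n -> R[i]}.

(* Tsigma_entry s X c d is the entry of T_s(X) in column c, d rows below the  *)
(* top row.                                                                   *)
Fixpoint Tsigma_entry (R : realType) (n : nat) (s : 'S_n) (X : 'rV[R[i]]_n)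
    (c : 'I_n) (d : nat) : R[i] :=
  if d is d'.+1 then
    let y := Tsigma_entry s X c d' in
    if arrow_up (Gsigma s) (n.-1 - d') c then y + 1 else y
  else X 0 (s^-1%g c).

Definition Tsigma (R : realType) (n : nat) (s : 'S_n) (X : 'rV[R[i]]_n) :
    tableau R n :=
  [ffun v => Tsigma_entry s X (vcol v) (n.-1 - vrow v)].

Definition wf_graph (n : nat) (G : graph n) : Prop :=
  (forall u v, arrow G u v ->
     [\/ vrow u = (vrow v).+1 :> nat, vrow v = (vrow u).+1 :> nat
       | is_top u /\ is_top v])
  /\ (forall u v, arrow G u v -> ~~ reach G v u).

Definition noncritical (n : nat) (G : graph n) : Prop :=
  forall u v : vertex n, vrow u = vrow v -> ~~ is_top u ->
    same_component G u v -> reach G u v || reach G v u.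

Definition satisfies (R : realType) (n : nat) (G : graph n) (L : tableau R n) :
    Prop :=
  forall u v, arrow G u v ->
    if (vrow u < vrow v)%N then is_pos_int (L u - L v)
    else is_nonneg_int (L u - L v).

Definition realization (R : realType) (n : nat) (G : graph n)
    (L : tableau R n) : Prop :=
  satisfies G L /\
  forall u v : vertex n, vrow u = vrow v -> ~~ is_top u ->
    is_int (L u - L v) -> same_component G u v.

Definition int_shift (R : realType) (n : nat) (L M : tableau R n) : Prop :=
  exists z : vertex n -> int,
    (forall v, is_top v -> z v = 0) /\ (forall v, M v = L v + (z v)%:~R).

Notation basis G L := {M | `[< realization G M /\ int_shift L M >]}.

(* Finitely supported functions basis G L -> R[i]. *)
Definition VG (R : realType) (n : nat) (G : graph n) (L : tableau R n) :
    lmodType R[i] :=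
  {malg R[i][basis G L]}.

(* The value 0 when M is not a basis element implements the convention that   *)
(* summands whose tableau is not a G-realization vanish.                      *)
Definition tabvec (R : realType) (n : nat) (G : graph n) (L M : tableau R n) :
    VG G L :=
  if insub M is Some b then mkmalgU (b : basis G L) 1 else 0.

Definition tab_add (R : realType) (n : nat) (M : tableau R n) (v : vertex n)
    (x : R[i]) : tableau R n :=
  [ffun w => if w == v then M w + x else M w].

Definition coef_den (R : realType) (n : nat) (M : tableau R n) (v : vertex n) :
    R[i] :=
  \prod_(w | (vrow w == vrow v) && (w != v)) (M v - M w).

Definition coef_raise (R : realType) (n : nat) (M : tableau R n)
    (v : vertex n) : R[i] :=
  (\prod_(w | vrow w == (vrow v).+1 :> nat) (M v - M w)) / coef_den M v.

Definition coef_lower (R : realType) (n : nat) (M : tableau R n)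
    (v : vertex n) : R[i] :=
  (\prod_(w | (vrow w).+1 == vrow v :> nat) (M v - M w)) / coef_den M v.

Definition GT_weight (R : realType) (n : nat) (M : tableau R n) (k : 'I_n) :
    R[i] :=
  k%:R + \sum_(v | vrow v == k) M v - \sum_(v | (vrow v).+1 == k :> nat) M v.

Definition gl_module (R : realType) (n : nat) (M : lmodType R[i])
    (rho : 'M[R[i]]_n -> M -> M) : Prop :=
  [/\ forall A, linear (rho A),
      forall x, linear (rho^~ x)
    & forall A B x,
        rho (A *m B - B *m A) x = rho A (rho B x) - rho B (rho A x)].

Definition GT_formulas (R : realType) (n : nat) (G : graph n)
    (L : tableau R n) (rho : 'M[R[i]]_n -> VG G L -> VG G L) : Prop :=
  forall b : basis G L, let M := val b in
  [/\ forall k k' : 'I_n, k' = k.+1 :> nat ->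
        rho (delta_mx k k') (tabvec G L M)
        = - \sum_(v | vrow v == k)
              coef_raise M v *: tabvec G L (tab_add M v 1),
      forall k k' : 'I_n, k' = k.+1 :> nat ->
        rho (delta_mx k' k) (tabvec G L M)
        = \sum_(v | vrow v == k)
              coef_lower M v *: tabvec G L (tab_add M v (-1))
    & forall k : 'I_n,
        rho (delta_mx k k) (tabvec G L M) = GT_weight M k *: tabvec G L M].

(* The formulas prescribe the action of a generating set of gl_n, so there is *)
(* at most one such rho for given G and L.                                    *)
Definition GT_module (R : realType) (n : nat) (G : graph n)
    (L : tableau R n) (rho : 'M[R[i]]_n -> VG G L -> VG G L) : Prop :=
  gl_module rho /\ GT_formulas rho.

Definition relation_graph (R : realType) (n : nat) (G : graph n) : Prop :=
  [/\ wf_graph G, noncritical G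
    & forall L : tableau R n, realization G L ->
        exists rho : 'M[R[i]]_n -> VG G L -> VG G L, GT_module rho].

Definition pregraph (R : realType) (n : nat) (L : tableau R n) : graph n :=
  [set e : vertex n * vertex n | let u := e.1 in let v := e.2 in
    `[< [\/ vrow u = (vrow v).+1 :> nat /\ is_nonneg_int (L u - L v),
            vrow v = (vrow u).+1 :> nat /\ is_pos_int (L u - L v)
          | [/\ is_top u /\ is_top v, u <> v, is_nonneg_int (L u - L v)
              & L u = L v -> (vcol u < vcol v)%N]] >]].

Definition same_reach (n : nat) (G H : graph n) : bool :=
  [forall u, forall v, reach H u v == reach G u v].

Definition transitive_reduction (n : nat) (G H : graph n) : bool :=
  minset (same_reach G) H.

(* The default value set0 is never used, see tableau_graphP and               *)
(* tableau_graph_unique.                                                      *)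
Definition tableau_graph (R : realType) (n : nat) (L : tableau R n) : graph n :=
  odflt set0 [pick H | transitive_reduction (pregraph L) H].

Definition highest_weight_vector (R : realType) (n : nat) (M : lmodType R[i])
    (rho : 'M[R[i]]_n -> M -> M) (s : 'S_n) (lam : 'rV[R[i]]_n) (x : M) : Prop :=
  [/\ x <> 0,
      forall i, rho (delta_mx (s i) (s i)) x = lam 0 i *: x
    & forall i j : 'I_n, (i < j)%N -> rho (delta_mx (s i) (s j)) x = 0].

Definition submodule (R : realType) (n : nat) (M : lmodType R[i])
    (rho : 'M[R[i]]_n -> M -> M) (W : M -> Prop) : Prop :=
  [/\ W 0,
      forall (a : R[i]) x y, W x -> W y -> W (a *: x + y)
    & forall A x, W x -> W (rho A x)].

Definition generated_by (R : realType) (n : nat) (M : lmodType R[i])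
    (rho : 'M[R[i]]_n -> M -> M) (x : M) : Prop :=
  forall W : M -> Prop, submodule rho W -> W x -> forall y, W y.

Definition highest_weight_module (R : realType) (n : nat) (M : lmodType R[i])
    (rho : 'M[R[i]]_n -> M -> M) (s : 'S_n) (lam : 'rV[R[i]]_n) : Prop :=
  exists x : M, highest_weight_vector rho s lam x /\ generated_by rho x.

Definition lambda_bar (R : realType) (n : nat) (lam : 'rV[R[i]]_n) :
    'rV[R[i]]_n :=
  \row_i (lam 0 i - i%:R).

Section GsigmaSpec.
Variable n : nat.

Lemma vertex_inj (u v : vertex n) :
  vrow u = vrow v :> nat -> vcol u = vcol v :> nat -> u = v.
Proof.
move=> /ord_inj hr /ord_inj hc; apply: val_inj.
by move: hr hc; rewrite /vrow /vcol; case: (val u) (val v) => [a b] [c d] /= -> ->.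
Qed.

Lemma has_arrowE (G : graph n) (u v : vertex n) :
  has_arrow G (vrow u : nat, vcol u : nat) (vrow v : nat, vcol v : nat)
  = arrow G u v.
Proof.
apply/existsP/idP => [[[u' v'] /and5P[/= uvG]]|uvG]; last first.
  by exists (u, v); rewrite /= !eqxx !andbT.
move=> /eqP h1 /eqP h2 /eqP h3 /eqP h4.
by rewrite /arrow -(vertex_inj h1 h2) -(vertex_inj h3 h4).
Qed.

Lemma arrow_downE (G : graph n) (u v : vertex n) :
  vcol u = vcol v -> vrow u = (vrow v).+1 :> nat ->
  arrow_down G (vrow u) (vcol u) = arrow G u v.
Proof. by move=> hc hr; rewrite -has_arrowE /arrow_down hc hr. Qed.

Lemma arrow_upE (G : graph n) (u v : vertex n) :
  vcol u = vcol v -> vrow u = (vrow v).+1 :> nat ->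
  arrow_up G (vrow u) (vcol u) = arrow G v u.
Proof. by move=> hc hr; rewrite -has_arrowE /arrow_up hc hr. Qed.

Lemma vertex_pair (r c : 'I_n) : (c < r)%N ->
  exists u v : vertex n,
    [/\ vrow u = r, vcol u = c, vcol v = c & vrow u = (vrow v).+1 :> nat].
Proof.
move=> cr; have r0 : (0 < r)%N by apply: leq_ltn_trans cr.
have hr : (r.-1 < n)%N by apply: leq_ltn_trans (leq_pred _) _.
have h1 : ((r, c).2 <= (r, c).1)%N by apply: ltnW.
have h2 : ((Ordinal hr, c).2 <= (Ordinal hr, c).1)%N by rewrite /= -ltnS prednK.
exists (exist _ (r, c) h1), (exist _ (Ordinal hr, c) h2).
by split=> //=; rewrite /vrow /= prednK.
Qed.

Lemma perm_posrootsE (s : 'S_n) (i j : 'I_n) :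
  ((i, j) \in perm_roots s (posroots n)) = (s^-1%g i < s^-1%g j)%N.
Proof.
apply/imsetP/idP => [[[a b]]|h].
  by rewrite inE /= => ab [-> ->]; rewrite !permK.
by exists (s^-1%g i, s^-1%g j); rewrite ?inE //= !permKV.
Qed.

Lemma Sigma_arrow (G : graph n) (u v : vertex n) (s : 'S_n) :
  G \in Sigma n -> Qroots G = perm_roots s (posroots n) ->
  arrow G u v = (vcol u == vcol v) &&
    ((vrow u == (vrow v).+1 :> nat) && (s^-1%g (vcol u) < s^-1%g (vrow u))%N
  || (vrow v == (vrow u).+1 :> nat) && (s^-1%g (vrow v) < s^-1%g (vcol v))%N).
Proof.
rewrite inE => /andP[/forallP hex /forall_inP honly] hQ.
case: (boolP ((vcol u == vcol v) && ((vrow u == (vrow v).+1 :> nat)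
   || (vrow v == (vrow u).+1 :> nat)))) => [/andP[/eqP hc hr]|hn]; last first.
  apply/idP/idP => [/honly/= h|]; first by rewrite h in hn.
  move=> /andP[hc /orP[]/andP[hr _]]; move: hn; by rewrite hc hr ?orbT.
rewrite hc eqxx /=.
have key (x y : vertex n) : vcol x = vcol y -> vrow x = (vrow y).+1 :> nat ->
  arrow G x y = (s^-1%g (vcol x) < s^-1%g (vrow x))%N /\
  arrow G y x = (s^-1%g (vrow x) < s^-1%g (vcol x))%N.
  move=> hcxy hrxy.
  have hlt : (vcol x < vrow x)%N.
    by rewrite hrxy ltnS hcxy; exact: (valP y).
  rewrite -!perm_posrootsE -hQ !inE /= hlt (ltnNge (vrow x)) (ltnW hlt) /=.
  by rewrite (arrow_downE _ hcxy hrxy) (arrow_upE _ hcxy hrxy) orbF.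
case/orP: hr => /eqP hr.
  have [-> _] := key _ _ hc hr.
  by rewrite hr eqxx -hc ltn_eqF ?orbF // ltnS leqnSn.
have [_ ->] := key _ _ (esym hc) hr.
by rewrite hr eqxx ltn_eqF //= ?ltnS ?leqnSn.
Qed.

Lemma Gsigma_spec_ex (s : 'S_n) : exists G : graph n,
  G \in Sigma n /\ Qroots G = perm_roots s (posroots n).
Proof.
pose G : graph n := [set e | (vcol e.1 == vcol e.2) &&
    ((vrow e.1 == (vrow e.2).+1 :> nat)
       && (s^-1%g (vcol e.1) < s^-1%g (vrow e.1))%N
  || (vrow e.2 == (vrow e.1).+1 :> nat)
       && (s^-1%g (vrow e.2) < s^-1%g (vcol e.2))%N)].
have GE (r c : 'I_n) : (c < r)%N ->
    arrow_down G r c = (s^-1%g c < s^-1%g r)%N /\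
    arrow_up G r c = (s^-1%g r < s^-1%g c)%N.
  move=> /vertex_pair[u [v [<- <- hc hr]]].
  rewrite (arrow_downE _ (esym hc) hr) (arrow_upE _ (esym hc) hr) /arrow !inE /=.
  by rewrite hc hr !eqxx /= [_ == _.+2]ltn_eqF ?orbF.
exists G; split.
  rewrite inE; apply/andP; split; last first.
    apply/forall_inP => e; rewrite inE => /andP[-> /=].
    by case/orP=> /andP[-> _]; rewrite ?orbT.
  apply/forallP => r; apply/forallP => c; apply/implyP => cr.
  have [-> ->] := GE _ _ cr.
  case: ltngtP => // /ord_inj/perm_inj h; by rewrite h ltnn in cr.
apply/setP => -[i j]; rewrite perm_posrootsE !inE /=.
case: (ltngtP i j) => [ij|ji|/ord_inj ->] /=; last by rewrite ltnn.
  by rewrite orbF; have [-> _] := GE _ _ ij.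
by have [_ ->] := GE _ _ ji.
Qed.

Lemma GsigmaP (s : 'S_n) :
  Gsigma s \in Sigma n /\ Qroots (Gsigma s) = perm_roots s (posroots n).
Proof.
rewrite /Gsigma; case: pickP => [G /andP[? /eqP ?] //|h].
by have [G [h1 h2]] := Gsigma_spec_ex s; have := h G; rewrite h1 h2 eqxx.
Qed.

Lemma Gsigma_unique (s : 'S_n) (G : graph n) :
  G \in Sigma n -> Qroots G = perm_roots s (posroots n) -> G = Gsigma s.
Proof.
move=> h1 h2; have [h3 h4] := GsigmaP s; apply/setP => -[u v].
exact: etrans (Sigma_arrow u v h1 h2) (esym (Sigma_arrow u v h3 h4)).
Qed.

End GsigmaSpec.

Lemma Tsigma_top (R : realType) (n : nat) (s : 'S_n) (X : 'rV[R[i]]_n)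
    (v : vertex n) : is_top v -> Tsigma s X v = X 0 (s^-1%g (vcol v)).
Proof.
move=> /eqP h; rewrite ffunE (_ : (n.-1 - vrow v)%N = 0%N) //.
by apply/eqP; rewrite subn_eq0 -ltnS prednK ?h // -h.
Qed.

Lemma Tsigma_rec (R : realType) (n : nat) (s : 'S_n) (X : 'rV[R[i]]_n)
    (u v : vertex n) : vcol u = vcol v -> vrow u = (vrow v).+1 :> nat ->
  (arrow (Gsigma s) u v -> Tsigma s X v = Tsigma s X u) /\
  (arrow (Gsigma s) v u -> Tsigma s X v = Tsigma s X u + 1).
Proof.
move=> hc hr; have hu := ltn_ord (vrow u).
have hu' : (vrow u <= n.-1)%N by rewrite -ltnS prednK // (leq_trans _ hu).
have e1 : (n.-1 - vrow v)%N = (n.-1 - vrow u).+1.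
  by rewrite hr subnS prednK // subn_gt0 -hr.
have e2 : (n.-1 - (n.-1 - vrow u))%N = vrow u by rewrite subKn.
rewrite [Tsigma s X v]ffunE e1 /= e2 -hc (arrow_upE _ hc hr) ffunE.
have [hS hQ] := GsigmaP s.
split=> h; last by rewrite h.
have -> : arrow (Gsigma s) v u = false; last by [].
apply/negbTE/negP => h'; move: hS; rewrite inE => /andP[/forallP /(_ (vrow u))].
move=> /forallP /(_ (vcol u)) + _; rewrite {1}hr ltnS {1}hc (valP v) /=.
by rewrite (arrow_downE _ hc hr) (arrow_upE _ hc hr) h h'.
Qed.

Lemma tableau_graphP (R : realType) (n : nat) (L : tableau R n) :
  transitive_reduction (pregraph L) (tableau_graph L).
Proof.
rewrite /tableau_graph; case: pickP => //= h.
have p0 : same_reach (pregraph L) (pregraph L).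
  by apply/forallP => u; apply/forallP.
have [H hH _] := minset_exists p0.
by have := h H; rewrite /transitive_reduction hH.
Qed.

Section ReductionUnique.
Variable n : nat.

Lemma reach_avoid (H : graph n) (e a b : _) :
  reach H a b -> ~~ (reach H a e.1 && reach H e.2 b) -> reach (H :\ e) a b.
Proof.
move=> /connectP[p]; elim: p a => [|x p IH] a /=.
  by move=> _ -> _; apply: connect0.
move=> /andP[ax xp] bE hne.
have xb : reach H x b by apply/connectP; exists p.
have ax' : arrow (H :\ e) a x.
  rewrite /arrow !inE (ax : (a, x) \in H) andbT.
  apply: contra hne => /eqP <-; by rewrite /= xb /reach connect0.
apply: connect_trans (connect1 ax') _; apply: IH => //.
apply: contra hne => /andP[xe ->]; rewrite andbT.
exact: connect_trans (connect1 ax) xe.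
Qed.

Lemma reach_del (H : graph n) (e : vertex n * vertex n) :
  reach (H :\ e) e.1 e.2 -> reach (H :\ e) =2 reach H.
Proof.
move=> he a b; apply/idP/idP.
  by apply: connect_sub => x y; rewrite /arrow inE => /andP[_ h]; apply: connect1.
apply: connect_sub => x y xy; case: (eqVneq (x, y) e) => [eE|ne].
  by move: he; rewrite -eE.
by apply: connect1; rewrite /arrow !inE ne.
Qed.

Lemma reduction_unique (G H1 H2 : graph n) :
  (forall u v, reach G u v -> reach G v u -> u = v) ->
  transitive_reduction G H1 -> transitive_reduction G H2 -> H1 = H2.
Proof.
move=> anti; wlog suff sub : H1 H2 / transitive_reduction G H1 ->
    transitive_reduction G H2 -> H1 \subset H2.
  by move=> h1 h2; apply/eqP; rewrite eqEsubset !sub.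
move=> /minsetP[s1 m1] /minsetP[s2 _].
have r1 u v : reach H1 u v = reach G u v.
  by move/forallP: s1 => /(_ u)/forallP/(_ v)/eqP.
have r2 u v : reach H2 u v = reach G u v.
  by move/forallP: s2 => /(_ u)/forallP/(_ v)/eqP.
apply/subsetP => -[u v] uv1; apply/negPn/negP => uv2.
suff h : reach (H1 :\ (u, v)) u v.
  have /setP/(_ (u, v)) : H1 :\ (u, v) = H1.
    apply: m1; last exact: subD1set.
    apply/forallP => a; apply/forallP => b; rewrite -r1; apply/eqP.
    exact: (reach_del (e := (u, v))).
  by rewrite !inE eqxx uv1.
have [<-|neuv] := eqVneq u v; first exact: connect0.
have : reach H2 u v by rewrite r2 -r1; apply: connect1.
move=> /connectP[p0 hp0 vE]; case: (shortenP hp0) vE => -[|x p] /=.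
  by move=> _ _ _ e; rewrite e eqxx in neuv.
move=> /andP[ux xp] /and3P[unx _ _] _ vE.
have xu : x != u by apply: contra unx => /eqP ->; rewrite inE eqxx.
have xv : x != v by apply: contraNneq uv2 => <-.
have gux : reach G u x by rewrite -r2; apply: connect1.
have gxv : reach G x v by rewrite -r2; apply/connectP; exists p.
apply: (@connect_trans _ _ x).
  apply: (@reach_avoid H1 (u, v)); rewrite /= ?r1 //; apply/negP => /andP[_ vx].
  by rewrite (anti _ _ gxv vx) eqxx in xv.
apply: (@reach_avoid H1 (u, v)); rewrite /= ?r1 //; apply/negP => /andP[xu' _].
by rewrite (anti _ _ gux xu') eqxx in xu.
Qed.

Lemma pregraph_anti (R : realType) (L : tableau R n) (u v : vertex n) :
  reach (pregraph L) u v -> reach (pregraph L) v u -> u = v.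
Proof.
pose f (u : vertex n) := ((n - vrow u) * n + vcol u)%N.
pose P u v := exists m : nat, L u - L v = m%:R /\ (m = 0%N -> (f u < f v)%N).
have arrP x y : arrow (pregraph L) x y -> P x y.
  rewrite /arrow inE => /asboolP /= [[hr [m hm]]|[hr [m hm]]|].
  - exists m; split=> // _; rewrite /f hr.
    have hy : ((vrow y).+1 < n)%N by rewrite -hr.
    rewrite -(subnSK (ltnW hy)) mulSn -addnA addnCA ltn_add2l.
    by rewrite ltn_addr // ltn_ord.
  - by exists m.+1.
  - move=> [[/eqP tx /eqP ty] _ [m hm] hlt]; exists m; split=> // m0.
    have hrow : vrow x = vrow y :> nat by apply: succn_inj; rewrite tx ty.
    rewrite /f hrow ltn_add2l; apply: hlt.
    by apply/eqP; rewrite -subr_eq0 hm m0.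
have Ptrans x y z : P x y -> P y z -> P x z.
  move=> [m [hm fm]] [k [hk fk]]; exists (m + k)%N; split.
    by rewrite natrD -hm -hk addrA subrK.
  by move=> /eqP; rewrite addn_eq0 => /andP[/eqP/fm h /eqP/fk]; apply: ltn_trans.
have Pirr x : ~ P x x.
  move=> [m []]; rewrite subrr => /esym/eqP; rewrite pnatr_eq0 => /eqP -> h.
  by have := h erefl; rewrite ltnn.
have reachP x y : reach (pregraph L) x y -> x = y \/ P x y.
  move=> /connectP[p]; elim: p x => [|z p IH] x /=; first by move=> _ ->; left.
  move=> /andP[/arrP xz zp] yE; right.
  by case: (IH _ zp yE) => [<-//|]; apply: Ptrans.
move=> /reachP[//|uv] /reachP[//|vu]; by case: (Pirr u); apply: Ptrans vu.
Qed.

End ReductionUnique.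

Lemma tableau_graph_unique (R : realType) (n : nat) (L : tableau R n)
    (H : graph n) :
  transitive_reduction (pregraph L) H -> H = tableau_graph L.
Proof.
move=> h; apply: reduction_unique h (tableau_graphP L) => u v.
exact: pregraph_anti.
Qed.

(* Main.v *)
(* Write P for the graph of T before transitive reduction. A tableau T + z is a
   basis vector of V_G(T) iff all its gaps along the arrows of P are nonnegative.
   Noncriticality makes the entries of each row below the top one pairwise
   distinct. The product of the two coefficients of a unit step M <-> M + delta^v
   is, up to sign and nonzero denominators, the product of the gaps of M at v, so
   it vanishes exactly when the step enters or leaves the basis.

   T generates V_G(T): unit steps inside the basis join T to every basis tableau,
   so let W be a submodule containing a basis tableau M. Applying E_{k,k+1} gives
   a combination of the M + delta^u, u in row k, whose summands have to be split.
   Suppose that some diagonal operator built from the action separates them. Then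
   E' : M |-> - sum_u M_u a_u (M + delta^u), where - a_u are the coefficients of
   E_{k,k+1}, is also built from the action, and [E', E_{k+1,k}] is again
   diagonal. Its eigenvalue is a first moment; the zeroth moment is known from
   [E_{k,k+1}, E_{k+1,k}] = E_{kk} - E_{k+1,k+1}. As both are affine in each entry
   of row k + 1, the zeroth moment determines how the first one changes when the
   entry M_w of row k + 1 grows by one: by w_{k+1}(M) - w_k(M) - M_w, where w_k is
   the eigenvalue of E_{kk}. So row k + 1 is separated too.

   T is a highest weight vector: if T + z is a basis tableau, the relations along
   each column give sum_k s^-1(k) (w_k(T + z) - w_k(T)) >= 0, whereas
   E_{s(i) s(j)} T with i < j has weights for which this sum is i - j < 0. *)
Require Import Defs.
From HB Require Import structures.
From mathcomp Require Import all_boot all_order all_algebra all_fingroup.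
From mathcomp Require Import boolp reals.
From mathcomp Require Import finmap complex monalg.
From mathcomp Require Import ring zify.

Set Implicit Arguments.
Unset Strict Implicit.
Unset Printing Implicit Defensive.

Import Order.TTheory GRing.Theory Num.Theory.

Local Open Scope ring_scope.

Lemma acyclic_source (I : finType) (e : rel I) (Q : pred I) (x : I) :
  (forall y z, e y z -> ~~ connect e z y) -> Q x ->
  exists2 y, Q y & forall z, e z y -> ~~ Q z.
Proof.
move=> acyclic Qx; pose below y := [pred z | connect e z y].
case: (@arg_minnP _ x Q (fun y => #|below y|) Qx) => y Qy ymin.
exists y => // z ezy; apply/negP => /ymin; apply/negP; rewrite -ltnNge.
apply/proper_card/properP; split.
  by apply/subsetP => w; rewrite !inE => wz; apply: connect_trans wz (connect1 ezy).
by exists y; rewrite !inE ?connect0 ?acyclic.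
Qed.

Lemma acyclic_sink (I : finType) (e : rel I) (Q : pred I) (x : I) :
  (forall y z, e y z -> ~~ connect e z y) -> Q x ->
  exists2 y, Q y & forall z, e y z -> ~~ Q z.
Proof.
move=> acyclic; apply: (@acyclic_source _ (fun y z => e z y)) => y z.
by rewrite connect_rev /=; apply: acyclic.
Qed.

Lemma sum_ord_ltn (n : nat) (k : 'I_n) : (\sum_(c < n) (c < k) = k)%N.
Proof.
rewrite -[RHS]card_ord -sum1_card (big_ord_widen n (fun=> 1%N)); last exact: ltnW.
by rewrite [RHS]big_mkcond; apply: eq_bigr => c _; case: ifP.
Qed.

Lemma mkmalgU_scale (A : nzRingType) (K : choiceType) (k : K) (a : A) :
  mkmalgU k a = a *: mkmalgU k 1 :> {malg A[K]}.
Proof. by apply/malgP => c; rewrite mcoeffZ !mcoeffU mulr_natr. Qed.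

Lemma scale_vector_inj (K : fieldType) (V : lmodType K) (x : V) :
  x != 0 -> injective (fun a : K => a *: x).
Proof.
move=> nz a b /eqP; rewrite -subr_eq0 -scalerBl scaler_eq0 (negbTE nz) orbF.
by rewrite subr_eq0 => /eqP.
Qed.

Section Subspaces.
Variables (K : fieldType) (V : lmodType K) (W : V -> Prop).
Hypotheses (W0 : W 0) (W_lin : forall a x y, W x -> W y -> W (a *: x + y)).

Lemma subspaceZ a x : W x -> W (a *: x).
Proof. by move=> Wx; rewrite -[_ *: _]addr0; apply: W_lin. Qed.

Lemma subspaceB x y : W x -> W y -> W (x - y).
Proof. by move=> Wx Wy; rewrite addrC -scaleN1r; apply: W_lin. Qed.

Lemma subspace_sum (I : Type) (r : seq I) (Q : pred I) (F : I -> V) :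
  (forall i, Q i -> W (F i)) -> W (\sum_(i <- r | Q i) F i).
Proof.
by move=> WF; apply: (big_ind W) => // x y Wx Wy; rewrite -[x]scale1r; apply: W_lin.
Qed.

(* Applying [X - eta a] to the sum removes its summand at [a]. *)
Lemma stable_subspace_eigen (X : {linear V -> V}) (I : eqType) (r : seq I)
    (x : I -> V) (eta : I -> K) :
  (forall y, W y -> W (X y)) -> uniq r -> {in r &, injective eta} ->
  {in r, forall u, X (x u) = eta u *: x u} ->
  W (\sum_(u <- r) x u) -> {in r, forall u, W (x u)}.
Proof.
move=> WX; elim: r x => [|a r IH] x //= /andP[a_notin uniq_r] inj eig.
rewrite big_cons => Wsum.
have in_r u : u \in r -> u \in a :: r by rewrite inE => ->; rewrite orbT.
have Wr : {in r, forall u, W (x u)}.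
  have Wr_scaled : {in r, forall u, W ((eta u - eta a) *: x u)}.
    apply: IH => // [u v /in_r u_in /in_r v_in|u /in_r/eig Xu|]; first exact: inj.
      by rewrite linearZ /= Xu !scalerA mulrC.
    have -> : \sum_(u <- r) (eta u - eta a) *: x u =
        X (x a + \sum_(u <- r) x u) - eta a *: (x a + \sum_(u <- r) x u).
      rewrite linearD linear_sum eig ?mem_head // scalerDr opprD addrACA subrr add0r.
      rewrite scaler_sumr -sumrB; apply: eq_big_seq => u /in_r/eig Xu.
      by rewrite scalerBl Xu.
    by apply: subspaceB; [apply: WX|apply: subspaceZ].
  move=> u u_in; have nz : eta u - eta a != 0.
    rewrite subr_eq0; apply: contraNneq a_notin => /inj <- //; first exact: in_r.
    exact: mem_head.
  by rewrite -[x u]scale1r -(mulVf nz) -scalerA; apply/subspaceZ/Wr_scaled.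
move=> u; rewrite inE => /predU1P[->|]; last exact: Wr.
rewrite -[x a](addrK (\sum_(u <- r) x u)); apply: subspaceB => //.
by rewrite big_seq; apply: subspace_sum.
Qed.

End Subspaces.

Lemma joint_eigenvalue (K : fieldType) (V : lmodType K) (I J : Type)
    (X : I -> {linear V -> V}) (r : seq J) (x : J -> V) (w : J -> I -> K)
    (mu : I -> K) :
  (forall i j, X i (x j) = w j i *: x j) ->
  (forall i, X i (\sum_(j <- r) x j) = mu i *: \sum_(j <- r) x j) ->
  \sum_(j <- r) x j != 0 -> exists j, w j =1 mu.
Proof.
elim: r x => [|a r IH] x Xx; first by rewrite big_nil eqxx.
move=> Xmu nz; have [eq_a|/existsNP[i /eqP neq]] := pselect (w a =1 mu).
  by exists a.
have sumE : \sum_(j <- r) (w j i - w a i) *: x j =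
    (mu i - w a i) *: \sum_(j <- a :: r) x j.
  rewrite scalerBl -Xmu linear_sum scaler_sumr -sumrB big_cons Xx subrr add0r.
  by apply: eq_bigr => j _; rewrite Xx scalerBl.
apply: (IH (fun j => (w j i - w a i) *: x j)) => [i' j|i'|]; last first.
- by rewrite sumE scaler_eq0 negb_or nz subr_eq0 eq_sym neq.
- by rewrite sumE linearZ /= Xmu !scalerA mulrC.
- by rewrite linearZ /= Xx !scalerA mulrC.
Qed.

Section Integers.
Variable R : realType.
Implicit Types x y : R[i].

Lemma is_intD x y : is_int x -> is_int y -> is_int (x + y).
Proof. by move=> [a ->] [b ->]; exists (a + b); rewrite intrD. Qed.

Lemma is_intN x : is_int x -> is_int (- x).
Proof. by move=> [a ->]; exists (- a); rewrite intrN. Qed.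

Lemma is_int_nat (m : nat) : is_int (m%:R : R[i]).
Proof. by exists m. Qed.

Lemma is_int_dichotomy x :
  is_int x -> is_nonneg_int x \/ is_nonneg_int (- x - 1).
Proof.
move=> [[m|m] ->]; [left|right]; exists m => //.
by rewrite NegzE intrN opprK -[_%:~R]/(m.+1%:R) -natr1 addrK.
Qed.

Lemma is_pos_intE x : is_pos_int x <-> is_nonneg_int (x - 1).
Proof.
split=> [[m ->]|[m xm]]; exists m; first by rewrite -natr1 addrK.
by rewrite -natr1 -xm subrK.
Qed.

Lemma nonneg_intr (a : int) : is_nonneg_int (a%:~R : R[i]) <-> 0 <= a.
Proof.
split=> [[m am]|]; last by case: a => // m _; exists m.
by have -> : a = m by apply: (@intr_inj R[i]).
Qed.

Lemma nonneg_intD x y : is_nonneg_int x -> is_nonneg_int y -> is_nonneg_int (x + y).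
Proof. by move=> [a ->] [b ->]; exists (a + b)%N; rewrite natrD. Qed.

Lemma nonneg_intB_le x (m k : nat) :
  (k <= m)%N -> is_nonneg_int (x - m%:R) -> is_nonneg_int (x - k%:R).
Proof.
move=> km [a xa]; exists (a + (m - k))%N.
by rewrite natrD natrB // -xa; ring.
Qed.

Lemma nonneg_intB1 x : is_nonneg_int x -> x != 0 -> is_nonneg_int (x - 1).
Proof. by move=> [[|m] ->]; rewrite ?eqxx // => _; exists m; rewrite -natr1 addrK. Qed.

Lemma nonneg_intN1 : ~ is_nonneg_int (-1 : R[i]).
Proof. by move/(nonneg_intr (-1)). Qed.

End Integers.

Section Rows.
Variable n : nat.
Implicit Types u v : vertex n.

Definition adjacent u v : bool :=
  (vrow u == (vrow v).+1 :> nat) || (vrow v == (vrow u).+1 :> nat).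

Lemma adjacent_sym u v : adjacent u v = adjacent v u.
Proof. exact: orbC. Qed.

Lemma adjacent_irr u : adjacent u u = false.
Proof. by rewrite /adjacent ltn_eqF. Qed.

Lemma eq_row_top u v : vrow u = vrow v -> is_top u = is_top v.
Proof. by rewrite /is_top => ->. Qed.

Lemma top_row u v : is_top u -> is_top v -> vrow u = vrow v.
Proof. by move=> /eqP tu /eqP tv; apply/val_inj/succn_inj; rewrite tu tv. Qed.

Lemma nontop_row u : ~~ is_top u -> ((vrow u).+1 < n)%N.
Proof. by move=> tu; rewrite ltn_neqAle tu ltn_ord. Qed.

Lemma same_component_sym (H : graph n) u v :
  same_component H u v = same_component H v u.
Proof. by apply: sym_connect_sym => x y /=; rewrite orbC. Qed.

End Rows.

(* The slack of a tableau at a possible arrow [u -> v]: relations become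
   nonnegativity of gaps, and a relation is tight when its gap is [0]. *)
Definition gap (R : realType) (n : nat) (M : tableau R n) (u v : vertex n) : R[i] :=
  M u - M v - (vrow u < vrow v)%N%:R.

Section Gap.
Variables (R : realType) (n : nat).
Implicit Types (M : tableau R n) (H : graph n) (u v w : vertex n).

Lemma satisfies_gap H M :
  satisfies H M <-> forall u v, arrow H u v -> is_nonneg_int (gap M u v).
Proof.
by split=> sat u v /sat; rewrite /gap; case: ifP => _; rewrite ?subr0 // is_pos_intE.
Qed.

Lemma gap_sym M u v : adjacent u v -> gap M v u = - gap M u v - 1.
Proof.
rewrite /gap; case: ltngtP => [_ _|_ _|uv] /=; [ring|ring|].
by rewrite /adjacent uv ltn_eqF.
Qed.

Lemma tab_addE M v e w : tab_add M v e w = M w + e *+ (w == v).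
Proof. by rewrite ffunE; case: eqP; rewrite ?addr0. Qed.

Lemma tab_add_eq M v e : tab_add M v e v = M v + e.
Proof. by rewrite tab_addE eqxx. Qed.

Lemma tab_add_neq M v e w : w != v -> tab_add M v e w = M w.
Proof. by move=> /negbTE wv; rewrite tab_addE wv addr0. Qed.

Lemma tab_add_neq_row M v e w : vrow w != vrow v -> tab_add M v e w = M w.
Proof. by move=> wv; apply/tab_add_neq/(contraNneq _ wv) => ->. Qed.

Lemma tab_addC M u v e d :
  tab_add (tab_add M u e) v d = tab_add (tab_add M v d) u e.
Proof. by apply/ffunP => w; rewrite !tab_addE addrAC. Qed.

Lemma tab_addK M v e : tab_add (tab_add M v e) v (- e) = M.
Proof. by apply/ffunP => w; rewrite !tab_addE mulNrn addrK. Qed.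

Lemma tab_addNK M v e : tab_add (tab_add M v (- e)) v e = M.
Proof. by rewrite -{2}[e]opprK tab_addK. Qed.

Lemma gap_tab_add M v e x y :
  gap (tab_add M v e) x y = gap M x y + (e *+ (x == v) - e *+ (y == v)).
Proof. by rewrite /gap !tab_addE; ring. Qed.

Lemma gap_tab_addr M v e w : w != v -> gap (tab_add M v e) w v = gap M w v - e.
Proof. by move=> /negbTE wv; rewrite gap_tab_add eqxx wv sub0r. Qed.

Lemma gap_shift (T M : tableau R n) (z : vertex n -> int) u v :
  (forall w, M w = T w + (z w)%:~R) -> gap M u v = gap T u v + (z u - z v)%:~R.
Proof. by move=> Mz; rewrite /gap !Mz intrB; ring. Qed.

Lemma satisfies_arrow_trans H M u x v (m : nat) :
  satisfies H M -> arrow H u x -> is_nonneg_int (M x - M v - m%:R) ->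
  is_nonneg_int (M u - M v - ((vrow u < vrow x)%N + m)%:R).
Proof.
move=> /satisfies_gap sat /sat ux xv; have := nonneg_intD ux xv.
by congr is_nonneg_int; rewrite /gap natrD; ring.
Qed.

Lemma satisfies_reach H M u v :
  wf_graph H -> satisfies H M -> reach H u v ->
  is_nonneg_int (M u - M v - (vrow v - vrow u)%N%:R).
Proof.
move=> [rows _] sat /connectP[p]; elim: p u => [|x p IH] u /=.
  by move=> _ ->; exists 0%N; rewrite subnn !subrr.
move=> /andP[ux xp] vE.
apply: nonneg_intB_le (satisfies_arrow_trans sat ux (IH x xp vE)).
case: (rows _ _ ux) => [->|->|[tu tx]]; last by rewrite (top_row tu tx) leq_addl.
  by lia.
by rewrite leqnn; lia.
Qed.

(* A nontrivial path returning to a row below the top one has an arrow going up. *)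
Lemma satisfies_reach_row H M u v :
  wf_graph H -> satisfies H M -> reach H u v -> u != v -> vrow u = vrow v ->
  ~~ is_top u -> is_nonneg_int (M u - M v - 1).
Proof.
move=> wfH sat /connectP[[|x p] /= up vE]; first by rewrite vE eqxx.
move=> _ uv tu; case/andP: up => ux xp.
have xv : reach H x v by apply/connectP; exists p.
have := satisfies_arrow_trans sat ux (satisfies_reach wfH sat xv).
apply: (@nonneg_intB_le _ _ _ 1); rewrite -uv.
case: (wfH.1 _ _ ux) => [->|->|[tu' _]]; last by rewrite tu' in tu.
  by rewrite subSnn addnC.
by rewrite leqnn.
Qed.

End Gap.

Section TableauGraph.
Variables (R : realType) (n : nat) (T : tableau R n).
Local Notation P := (pregraph T).
Local Notation G := (tableau_graph T).
Implicit Types u v w : vertex n.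

Lemma satisfies_pregraph : satisfies P T.
Proof.
move=> u v; rewrite /arrow inE => /asboolP/=[[-> down]|[-> up]|[[tu tv] _ flat _]].
- by rewrite ltnNge leqnSn.
- by rewrite leqnn.
- by rewrite (top_row tu tv) ltnn.
Qed.

Lemma pregraph_gap u v : arrow P u v -> is_nonneg_int (gap T u v).
Proof. by move: u v; apply/satisfies_gap/satisfies_pregraph. Qed.

Lemma gap_pregraph u v : adjacent u v -> is_nonneg_int (gap T u v) -> arrow P u v.
Proof.
rewrite /gap /arrow inE => /orP[]/eqP uv nonneg; apply/asboolP.
  by move: nonneg; rewrite uv ltnNge leqnSn subr0; constructor 1.
by move: nonneg; rewrite uv leqnn -is_pos_intE; constructor 2.
Qed.

Lemma pregraph_adjacent u v : arrow P u v -> adjacent u v || is_top u && is_top v.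
Proof.
rewrite /arrow inE => /asboolP/=[[uv _]|[uv _]|[[-> ->] _ _ _]]; last exact: orbT.
  by rewrite /adjacent uv eqxx.
by rewrite /adjacent uv eqxx orbT.
Qed.

Lemma pregraph_neq u v : arrow P u v -> u != v.
Proof.
move=> uv; apply: contraTneq uv => ->; rewrite /arrow inE.
by apply/asboolP => /= -[[/eqP]|[/eqP]|[_ //]]; rewrite ltn_eqF.
Qed.

Lemma pregraph_row_top u v : arrow P u v -> vrow u = vrow v -> is_top u.
Proof.
move=> /pregraph_adjacent/orP[adj uv|/andP[] //].
by move: adj; rewrite /adjacent uv ltn_eqF.
Qed.

Lemma pregraph_acyclic u v : arrow P u v -> ~~ reach P v u.
Proof.
move=> uv; apply: contra (pregraph_neq uv) => vu.
exact/eqP/(pregraph_anti (connect1 uv) vu).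
Qed.

Lemma pregraph_total u v : adjacent u v -> is_int (T u - T v) ->
  arrow P u v \/ arrow P v u.
Proof.
move=> uv int; have : is_int (gap T u v).
  exact: is_intD int (is_intN (is_int_nat _ _)).
move=> /is_int_dichotomy[nonneg|]; first by left; apply: gap_pregraph.
by rewrite -gap_sym // => nonneg; right; apply: gap_pregraph; rewrite 1?adjacent_sym.
Qed.

Lemma tableau_graph_sub : G \subset P.
Proof.
have refl : same_reach P P by apply/forallP => u; apply/forallP.
by have [H /tableau_graph_unique <-] := minset_exists refl.
Qed.

Lemma reach_tableau_graph u v : reach G u v = reach P u v.
Proof.
by have /minsetP[/forallP/(_ u)/forallP/(_ v)/eqP] := tableau_graphP T.
Qed.

Lemma pregraph_same_component u v : arrow P u v -> same_component G u v.
Proof.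
move=> /(@connect1 _ (arrow P)); rewrite -/(reach P u v) -reach_tableau_graph.
by apply: connect_sub => x y xy; apply: connect1; rewrite /= xy.
Qed.

Lemma adjacent_same_component u v : adjacent u v -> is_int (T u - T v) ->
  same_component G u v.
Proof.
move=> uv /(pregraph_total uv)[|]; first exact: pregraph_same_component.
by rewrite same_component_sym; apply: pregraph_same_component.
Qed.

Lemma tableau_graph_realization :
  (forall u, ~~ is_top u ->
     exists2 w, vrow w = (vrow u).+1 :> nat & is_int (T w - T u)) ->
  realization G T.
Proof.
move=> above; split=> [u v uv|u v uv tu int].
  exact/satisfies_pregraph/(subsetP tableau_graph_sub).
have [w wu int_w] := above u tu.
apply: (@connect_trans _ _ w).
  rewrite -/(same_component G u w) same_component_sym.
  by apply: adjacent_same_component; rewrite // /adjacent wu eqxx.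
apply: adjacent_same_component; first by rewrite /adjacent -uv wu eqxx.
by have := is_intD int_w int; rewrite addrA subrK.
Qed.

End TableauGraph.

Definition in_basis (R : realType) (n : nat) (T M : tableau R n) : Prop :=
  realization (tableau_graph T) M /\ int_shift T M.

Section Basis.
Variables (R : realType) (n : nat) (T : tableau R n).
Local Notation P := (pregraph T).
Local Notation G := (tableau_graph T).
Hypothesis (wfG : wf_graph G) (ncG : noncritical G) (realT : realization G T).
Implicit Types (M N : tableau R n) (u v w : vertex n).

Lemma in_basis_refl : in_basis T T.
Proof. by split=> //; exists (fun=> 0); split=> // v; rewrite addr0. Qed.

Lemma int_shiftB M u v : int_shift T M -> is_int ((M u - M v) - (T u - T v)).
Proof. by move=> [z [_ Mz]]; exists (z u - z v); rewrite !Mz intrB; ring. Qed.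

Lemma in_basis_gap M u v : in_basis T M -> arrow P u v -> is_nonneg_int (gap M u v).
Proof.
move=> [[sat _] _] uv; have : reach G u v.
  by rewrite reach_tableau_graph; apply: connect1.
move=> /(satisfies_reach wfG sat); apply: nonneg_intB_le.
by case: ltnP => // up; rewrite subn_gt0.
Qed.

Lemma in_basisP M : in_basis T M <->
  int_shift T M /\ forall u v, arrow P u v -> is_nonneg_int (gap M u v).
Proof.
split=> [bM|[shift gaps]]; first by split=> [|u v]; [case: bM|apply: in_basis_gap].
split=> //; split=> [|u v uv tu int].
  by apply/satisfies_gap => u v /(subsetP (tableau_graph_sub T)); apply: gaps.
apply: realT.2 => //; have := is_intD int (is_intN (int_shiftB u v shift)).
by rewrite opprB addrCA subrr addr0.
Qed.

Lemma in_basis_row_neq M u v : in_basis T M -> vrow u = vrow v -> ~~ is_top u ->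
  u != v -> M u != M v.
Proof.
move=> [[sat conn] _] uv tu neq; apply/eqP => Muv.
have unreachable x y : vrow x = vrow y -> ~~ is_top x -> x != y -> M x = M y ->
    ~ reach G x y.
  move=> xy tx nxy Mxy /(satisfies_reach_row wfG sat)/(_ nxy xy tx).
  by rewrite Mxy subrr sub0r; apply: nonneg_intN1.
have /(ncG uv tu)/orP[] : same_component G u v.
  by apply: conn => //; rewrite Muv subrr; apply: (is_int_nat _ 0).
  exact: unreachable.
by apply: unreachable; rewrite // 1?eq_sym // -(eq_row_top uv).
Qed.

Lemma int_shift_add M v e : ~~ is_top v -> int_shift T M -> is_int e ->
  int_shift T (tab_add M v e).
Proof.
move=> tv [z [z0 Mz]] [d ->]; exists (fun w => z w + d *+ (w == v)).
split=> w; last by rewrite tab_addE Mz intrD rmorphMn addrA.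
by move=> tw; rewrite z0 // (_ : (w == v) = false) //; apply: contraNF tv => /eqP <-.
Qed.

Lemma in_basis_add_nontop M v e :
  in_basis T M -> in_basis T (tab_add M v e) -> e != 0 -> ~~ is_top v.
Proof.
move=> [_ [z [z0 Mz]]] [_ [y [y0 My]]]; apply: contra => tv.
have /eqP := My v; rewrite tab_add_eq Mz z0 // y0 // !addr0 -subr_eq0.
by rewrite addrC addKr.
Qed.

Lemma in_basis_raise_blocked M v : in_basis T M -> ~~ is_top v ->
  ~ in_basis T (tab_add M v 1) -> exists2 w, arrow P w v & gap M w v = 0.
Proof.
move=> bM tv notin; apply: contrapT => nottight; apply/notin/in_basisP; split.
  exact: int_shift_add tv bM.2 (is_int_nat _ 1).
move=> x y xy; have xy_gap := in_basis_gap bM xy; rewrite gap_tab_add.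
have [yv|_] := eqVneq y v; last by rewrite subr0; apply: nonneg_intD xy_gap _; eexists.
rewrite -yv (negbTE (pregraph_neq xy)) sub0r; apply: nonneg_intB1 => //.
by apply/eqP => tight; apply: nottight; exists x; rewrite -yv.
Qed.

Lemma in_basis_lower_blocked M v : in_basis T M -> ~~ is_top v ->
  ~ in_basis T (tab_add M v (-1)) -> exists2 w, arrow P v w & gap M v w = 0.
Proof.
move=> bM tv notin; apply: contrapT => nottight; apply/notin/in_basisP; split.
  exact: int_shift_add tv bM.2 (is_intN (is_int_nat _ 1)).
move=> x y xy; have xy_gap := in_basis_gap bM xy; rewrite gap_tab_add.
have [xv|_] := eqVneq x v; last first.
  by rewrite sub0r mulNrn opprK; apply: nonneg_intD xy_gap _; eexists.
rewrite -xv eq_sym (negbTE (pregraph_neq xy)) subr0; apply: nonneg_intB1 => //.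
by apply/eqP => tight; apply: nottight; exists y; rewrite -xv.
Qed.

Lemma in_basis_raise_gap M v w : in_basis T M -> in_basis T (tab_add M v 1) ->
  adjacent w v -> gap M w v != 0.
Proof.
move=> bM bN wv; apply/eqP => tight.
have nwv : w != v by apply: contraTneq wv => ->; rewrite adjacent_irr.
have : is_int (T w - T v).
  have -> : T w - T v =
      gap M w v + (vrow w < vrow v)%N%:R - ((M w - M v) - (T w - T v)).
    by rewrite /gap; ring.
  rewrite tight add0r.
  exact: is_intD (is_int_nat _ _) (is_intN (int_shiftB w v bM.2)).
move=> /(pregraph_total wv)[/(in_basis_gap bN)|/(in_basis_gap bM)].
  by rewrite gap_tab_addr // tight sub0r; apply: nonneg_intN1.
by rewrite gap_sym // tight oppr0 sub0r; apply: nonneg_intN1.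
Qed.

(* No arrow joins [u] and [v], so every gap of [M + e delta^u] is a gap of one of
   the two tableaux in the hypotheses. *)
Lemma in_basis_exchange M u v e d : in_basis T M -> vrow u = vrow v -> u != v ->
  ~~ is_top u -> is_int e -> in_basis T (tab_add (tab_add M u e) v d) ->
  in_basis T (tab_add M u e).
Proof.
move=> bM uv neq tu int_e bN; apply/in_basisP; split=> [|x y xy].
  exact: int_shift_add tu bM.2 int_e.
have apart : vrow x = vrow u -> vrow y <> vrow u.
  move=> xu yu; have := pregraph_row_top xy (etrans xu (esym yu)).
  by rewrite (eq_row_top xu) (negbTE tu).
have [xy_v|/norP[xv yv]] := boolP ((x == v) || (y == v)); last first.
  have := in_basis_gap bN xy; rewrite [gap (tab_add _ v _) _ _]gap_tab_add.
  by rewrite (negbTE xv) (negbTE yv) subr0 addr0.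
have [xu yu] : (x == u) = false /\ (y == u) = false.
  case/orP: xy_v => /eqP xy_v; rewrite xy_v [v == u]eq_sym (negbTE neq); split=> //.
    by apply/eqP => yu; apply: apart; rewrite ?xy_v ?yu.
  by apply/eqP => xu; apply: apart; rewrite ?xy_v ?xu.
by rewrite gap_tab_add xu yu subr0 addr0; apply: in_basis_gap.
Qed.

Lemma in_basis_toward M (z : vertex n -> int) v0 : in_basis T M ->
  (forall v, is_top v -> z v = 0) -> (forall v, M v = T v + (z v)%:~R) ->
  z v0 != 0 ->
  exists v, z v < 0 /\ in_basis T (tab_add M v 1) \/
            0 < z v /\ in_basis T (tab_add M v (-1)).
Proof.
move=> bM z0 Mz nz.
have tight_le u v : arrow P u v -> gap M u v = 0 -> z u <= z v.
  move=> /pregraph_gap + /eqP; rewrite (gap_shift _ _ Mz) addr_eq0 -intrN opprB.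
  by move=> nonneg /eqP gapT; move: nonneg; rewrite gapT nonneg_intr subr_ge0.
have acyclic := @pregraph_acyclic _ _ T.
have nontop v : z v != 0 -> ~~ is_top v by apply: contra => /z0 ->.
have [neg|pos|zv0] := ltgtP (z v0) 0; last by rewrite zv0 in nz.
- have [v vneg vmin] := acyclic_source (Q := fun v => z v < 0) acyclic neg.
  exists v; left; split=> //; apply: contrapT.
  have tv := nontop v (ltr0_neq0 vneg).
  move=> /(in_basis_raise_blocked bM tv)[w wv /(tight_le _ _ wv) zw_le].
  by move: (vmin w wv); rewrite (le_lt_trans zw_le vneg).
- have [v vpos vmax] := acyclic_sink (Q := fun v => 0 < z v) acyclic pos.
  exists v; right; split=> //; apply: contrapT.
  have tv := nontop v (lt0r_neq0 vpos).
  move=> /(in_basis_lower_blocked bM tv)[w vw /(tight_le _ _ vw) zv_le].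
  by move: (vmax w vw); rewrite (lt_le_trans vpos zv_le).
Qed.

Lemma in_basis_ind (Q : tableau R n -> Prop) :
  Q T ->
  (forall M v, in_basis T M -> in_basis T (tab_add M v 1) -> Q M ->
     Q (tab_add M v 1)) ->
  (forall M v, in_basis T M -> in_basis T (tab_add M v (-1)) -> Q M ->
     Q (tab_add M v (-1))) ->
  forall M, in_basis T M -> Q M.
Proof.
move=> QT raise lower M bM; have [z [z0 Mz]] := bM.2.
have [m] := ubnP (\sum_v `|z v|%N)%N.
elim: m M z bM z0 Mz => // m IH M z bM z0 Mz; rewrite ltnS => le_m.
have [/existsP[v0 nz]|/existsPn zz] := boolP [exists v, z v != 0]; last first.
  suff -> : M = T by [].
  by apply/ffunP => v; rewrite Mz; have /negPn/eqP -> := zz v; rewrite addr0.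
have step v (e : int) : in_basis T (tab_add M v e%:~R) ->
    (`|(z v + e)%R| < `|z v|)%N -> e != 0 -> Q (tab_add M v e%:~R).
  move=> bN closer_v e0; apply: (IH _ (fun w => z w + e *+ (w == v)) bN) => [w tw|w|].
  - have tv : ~~ is_top v by apply: in_basis_add_nontop bM bN _; rewrite intr_eq0.
    by rewrite z0 // (_ : (w == v) = false) //; apply: contraNF tv => /eqP <-.
  - by rewrite tab_addE Mz intrD rmorphMn addrA.
  - apply: leq_trans le_m; rewrite (bigD1 v) //= [X in (_ < X)%N](bigD1 v) //= eqxx.
    rewrite (eq_bigr (fun w => `|z w|%N)) ?ltn_add2r //.
    by move=> w /negbTE ->; rewrite addr0.
have [v [[zv bN]|[zv bN]]] := in_basis_toward bM z0 Mz nz.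
  rewrite -(tab_addK M v 1); apply: lower; rewrite ?tab_addK //.
  by apply: (step v 1) => //; lia.
rewrite -(tab_addNK M v 1); apply: raise; rewrite ?tab_addNK //.
by apply: (step v (-1)) => //; lia.
Qed.

End Basis.

Section Coefficients.
Variables (R : realType) (n : nat).
Implicit Types (M N : tableau R n) (u v w : vertex n).

Lemma eq_coef_den M N u :
  (forall w, vrow w = vrow u -> M w = N w) -> coef_den M u = coef_den N u.
Proof.
by move=> eqMN; apply: eq_bigr => w /andP[/eqP wu _]; rewrite (eqMN u) ?(eqMN w).
Qed.

Lemma coef_den_add_row M u w e : vrow w = vrow u -> w != u -> M u != M w ->
  coef_den (tab_add M w e) u = coef_den M u * ((M u - M w - e) / (M u - M w)).
Proof.
rewrite -(subr_eq0 (M u)) => wu nwu nz; have wP : (vrow w == vrow u) && (w != u).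
  by rewrite wu eqxx.
rewrite /coef_den (bigD1 w wP) [in RHS](bigD1 w wP) /= tab_add_eq.
under eq_bigr => x /andP[_ xw] do rewrite (tab_add_neq _ _ xw).
by rewrite tab_add_neq 1?eq_sym //; field.
Qed.

Lemma coef_raise_add_row M u w e : vrow w = vrow u -> w != u -> M u != M w ->
  coef_raise (tab_add M w e) u = coef_raise M u * ((M u - M w) / (M u - M w - e)).
Proof.
move=> wu nwu neq; rewrite /coef_raise coef_den_add_row // invfM invf_div -mulrA.
congr (_ * _); apply: eq_bigr => x /eqP xu.
rewrite tab_add_neq 1?eq_sym // tab_add_neq_row //.
by rewrite -val_eqE /= wu xu gtn_eqF.
Qed.

Lemma coef_lower_add_row M u w e : vrow w = vrow u -> w != u -> M u != M w ->
  coef_lower (tab_add M w e) u = coef_lower M u * ((M u - M w) / (M u - M w - e)).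
Proof.
move=> wu nwu neq; rewrite /coef_lower coef_den_add_row // invfM invf_div -mulrA.
congr (_ * _); apply: eq_bigr => x /eqP xu.
rewrite tab_add_neq 1?eq_sym // tab_add_neq_row //.
by rewrite -val_eqE /= wu -xu ltn_eqF.
Qed.

Lemma coef_exchange M u v : vrow u = vrow v -> u != v -> M u != M v ->
  coef_lower M v * coef_raise (tab_add M v (-1)) u =
  coef_raise M u * coef_lower (tab_add M u 1) v.
Proof.
move=> uv nuv neq; rewrite coef_lower_add_row 1?[M v == _]eq_sym //.
rewrite eq_sym in nuv; rewrite coef_raise_add_row // mulrCA; congr (_ * (_ * _)).
by rewrite -[in RHS](opprB (M u)) -opprD invrN mulrNN opprK.
Qed.

Lemma coef_lower_add_above M u w e : vrow w = (vrow u).+1 :> nat ->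
  coef_lower (tab_add M w e) u = coef_lower M u.
Proof.
move=> wu; rewrite /coef_lower; congr (_ / _).
  apply: eq_bigr => x /eqP xu.
  by rewrite !tab_add_neq_row // -val_eqE /= wu ltn_eqF //; lia.
by apply: eq_coef_den => x xu; rewrite tab_add_neq_row // -val_eqE /= wu xu ltn_eqF.
Qed.

(* Up to sign, the coefficient of [M] in [E_{k+1,k} E_{k,k+1} M] that comes from
   moving the entry at [v], for [v] in row [k]. *)
Definition edge M v : R[i] := coef_raise M v * coef_lower (tab_add M v 1) v.

Lemma edgeE M v : edge M v = \prod_(w | adjacent w v) (- gap M w v) /
  (coef_den M v * coef_den (tab_add M v 1) v).
Proof.
rewrite /edge /coef_raise /coef_lower mulrACA -invfM; congr (_ / _).
rewrite [RHS](bigID (fun w => vrow w == (vrow v).+1 :> nat)) /=; congr (_ * _).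
  apply: eq_big => [w|w /eqP wv]; first by rewrite /adjacent; lia.
  by rewrite /gap wv ltnNge leqnSn subr0 opprB.
apply: eq_big => [w|w /eqP wv].
  by rewrite /adjacent; lia.
rewrite /gap -wv leqnn tab_add_eq tab_add_neq_row.
  by rewrite /=; ring.
by rewrite -val_eqE /= -wv ltn_eqF.
Qed.

Lemma edge_eq0 M v w : adjacent w v -> gap M w v = 0 -> edge M v = 0.
Proof. by move=> wv tight; rewrite edgeE (bigD1 w) //= tight oppr0 !mul0r. Qed.

Definition edge_but M u w : R[i] :=
  (\prod_(x | (vrow x == (vrow u).+1 :> nat) && (x != w)) (M u - M x)) / coef_den M u *
  coef_lower (tab_add M u 1) u.

Lemma edge_above M u w : vrow w = (vrow u).+1 :> nat ->
  edge M u = (M u - M w) * edge_but M u w.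
Proof.
by move=> /eqP wu; rewrite /edge /coef_raise (bigD1 w) //= /edge_but !mulrA.
Qed.

Lemma edge_add_above M u w e : vrow w = (vrow u).+1 :> nat ->
  edge (tab_add M w e) u = (M u - M w - e) * edge_but M u w.
Proof.
move=> wu; have row_neq x : vrow x = vrow u -> tab_add M w e x = M x.
  by move=> xu; rewrite tab_add_neq_row // -val_eqE /= wu xu ltn_eqF.
rewrite (edge_above _ wu) tab_add_eq row_neq // opprD addrA; congr (_ * _).
rewrite /edge_but tab_addC coef_lower_add_above //; congr (_ / _ * _).
  by apply: eq_bigr => x /andP[_ xw]; rewrite row_neq // tab_add_neq.
exact: eq_coef_den.
Qed.

Definition moment (phi : R[i] -> R[i]) M (k : 'I_n) : R[i] :=
  \sum_(u | vrow u == k)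
     (phi (M u) * edge M u - phi (M u - 1) * edge (tab_add M u (-1)) u).

(* Each [edge M u] is affine in the entry [M w] of the row above, so the zeroth
   moment at two tableaux determines the increment of the first one. *)
Lemma moment_id_add M (k : 'I_n) w : vrow w = k.+1 :> nat ->
  moment id (tab_add M w 1) k - moment id M k =
  M w * (moment (fun=> 1) (tab_add M w 1) k - moment (fun=> 1) M k) -
  moment (fun=> 1) M k.
Proof.
move=> wk; rewrite -!sumrB mulr_sumr -sumrB; apply: eq_bigr => u /eqP uk.
have wu : vrow w = (vrow u).+1 :> nat by rewrite uk.
have nuw : u != w by apply: contra_eqN wu => /eqP ->; rewrite ltn_eqF.
have nwu : w != u by rewrite eq_sym.
rewrite ![tab_add (tab_add M w 1) u _]tab_addC.
rewrite !(edge_add_above _ _ wu) !(edge_above _ wu).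
by rewrite tab_add_eq !tab_add_neq //; ring.
Qed.

Lemma GT_weight_add M v e :
  GT_weight (tab_add M v e) (vrow v) = GT_weight M (vrow v) + e.
Proof.
rewrite /GT_weight (bigD1 v) //= [in RHS](bigD1 v) //= tab_add_eq.
rewrite (eq_bigr M) => [|w /andP[_ wv]]; last by rewrite tab_add_neq.
rewrite [X in _ - X](eq_bigr M) => [|w /eqP wv]; first by ring.
by rewrite tab_add_neq_row // -val_eqE /= -wv ltn_eqF.
Qed.

Lemma GT_weight_add_above M v e (k : 'I_n) : (k < vrow v)%N ->
  GT_weight (tab_add M v e) k = GT_weight M k.
Proof.
move=> kv; have le_row w : (vrow w <= k)%N -> tab_add M v e w = M w.
  by move=> wk; rewrite tab_add_neq_row // -val_eqE /= ltn_eqF // (leq_ltn_trans wk).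
rewrite /GT_weight; congr (_ + _ - _); apply: eq_bigr => w /eqP wk; apply: le_row.
  by rewrite wk.
by rewrite -wk.
Qed.

Lemma GT_weight_row0 M u : vrow u = 0 :> nat -> GT_weight M (vrow u) = M u.
Proof.
move=> u0; rewrite /GT_weight u0 add0r [X in _ - X]big_pred0 // subr0.
rewrite (big_pred1 u) // => v; apply/eqP/eqP => [vu|-> //].
apply: vertex_inj; first by rewrite vu.
have := valP v; have := valP u; rewrite -/(vrow u) -/(vrow v) vu u0 !leqn0.
by move=> /eqP uc /eqP vc; rewrite /vcol uc vc.
Qed.

End Coefficients.

Section BasisCoefficients.
Variables (R : realType) (n : nat) (T : tableau R n).
Local Notation G := (tableau_graph T).
Hypothesis (wfG : wf_graph G) (ncG : noncritical G) (realT : realization G T).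
Implicit Types (M : tableau R n) (u v w : vertex n).

Lemma coef_den_neq0 M v : in_basis T M -> ~~ is_top v -> coef_den M v != 0.
Proof.
move=> bM tv; apply/prodf_neq0 => w /andP[/eqP wv nwv]; rewrite subr_eq0.
by apply: (in_basis_row_neq wfG ncG bM); rewrite 1?eq_sym.
Qed.

Lemma edge_neq0 M v : in_basis T M -> in_basis T (tab_add M v 1) -> edge M v != 0.
Proof.
move=> bM bN; have tv := in_basis_add_nontop bM bN (oner_neq0 _).
rewrite edgeE mulf_neq0 ?invr_neq0 ?mulf_neq0 ?coef_den_neq0 //.
by apply/prodf_neq0 => w wv; rewrite oppr_eq0; apply: (in_basis_raise_gap wfG bM bN).
Qed.

Lemma edge_raise_eq0 M v : in_basis T M -> ~~ is_top v ->
  ~ in_basis T (tab_add M v 1) -> edge M v = 0.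
Proof.
move=> bM tv /(in_basis_raise_blocked wfG realT bM tv)[w wv]; apply: edge_eq0.
by move: (pregraph_adjacent wv); rewrite (negbTE tv) andbF orbF.
Qed.

Lemma edge_lower_eq0 M v : in_basis T M -> ~~ is_top v ->
  ~ in_basis T (tab_add M v (-1)) -> edge (tab_add M v (-1)) v = 0.
Proof.
move=> bM tv /(in_basis_lower_blocked wfG realT bM tv)[w vw tight].
have wv : adjacent w v.
  by move: (pregraph_adjacent vw); rewrite (negbTE tv) orbF adjacent_sym.
have nwv : w != v by apply: contraTneq wv => ->; rewrite adjacent_irr.
apply: (edge_eq0 wv); rewrite gap_tab_addr // gap_sym 1?adjacent_sym // tight.
by ring.
Qed.

End BasisCoefficients.

(* A synonym of [rho] whose linearity is inferred. *)
Definition gl_act (R : realType) (n : nat) (V : lmodType R[i])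
  (rho : 'M[R[i]]_n -> V -> V) of gl_module rho : 'M[R[i]]_n -> V -> V := rho.

Section GlModule.
Variables (R : realType) (n : nat) (V : lmodType R[i]).
Variables (rho : 'M[R[i]]_n -> V -> V) (glrho : gl_module rho).
Local Notation act := (gl_act glrho).

Fact gl_act_linear A : linear (act A).
Proof. by have [lin _ _] := glrho; apply: lin. Qed.

HB.instance Definition _ A :=
  GRing.isLinear.Build R[i] V V *:%R (act A) (gl_act_linear A).

Lemma gl_actB A B x : act (A - B) x = act A x - act B x.
Proof.
have [_ /(_ x (-1) B A)/= + _] := glrho.
by rewrite !scaleN1r [- B + A]addrC [- _ + _ x]addrC.
Qed.

Lemma gl_act0 x : act 0 x = 0.
Proof. by have := gl_actB 0 0 x; rewrite !subrr. Qed.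

Lemma gl_act_bracket A B x :
  act (A *m B - B *m A) x = act A (act B x) - act B (act A x).
Proof. by have [_ _ bracket] := glrho; apply: bracket. Qed.

Lemma gl_act_root (k a b : 'I_n) (mu : R[i]) x :
  act (delta_mx k k) x = mu *: x ->
  act (delta_mx k k) (act (delta_mx a b) x) =
  (mu + ((k == a)%:Z - (k == b)%:Z)%:~R) *: act (delta_mx a b) x.
Proof.
move=> xmu; have /esym/eqP := gl_act_bracket (delta_mx k k) (delta_mx a b) x.
rewrite xmu linearZ subr_eq gl_actB !mul_delta_mx_cond => /eqP ->.
rewrite [RHS]scalerDl [RHS]addrC; congr (_ + _).
rewrite intrB scalerBl [b == k]eq_sym; congr (_ - _).
  by case: eqP => [->|_]; rewrite ?scale1r ?scale0r ?gl_act0.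
by case: eqP => [->|_]; rewrite ?scale1r ?scale0r ?gl_act0.
Qed.

(* Stands for membership in the image of the enveloping algebra. *)
Definition preserving (X : V -> V) : Prop :=
  forall W, submodule rho W -> forall x, W x -> W (X x).

Lemma preserving_act A : preserving (act A).
Proof. by move=> W [_ _ stable] x; apply: stable. Qed.

Lemma preserving_comp (X Y : {linear V -> V}) :
  preserving X -> preserving Y -> preserving (X \o Y).
Proof. by move=> pX pY W sW x Wx; apply: pX (pY _ sW _ Wx). Qed.

Lemma preserving_sub (X Y : {linear V -> V}) :
  preserving X -> preserving Y -> preserving (X \- Y).
Proof.
move=> pX pY W sW x Wx; have [W0 W_lin _] := sW.
by apply: subspaceB => //; [apply: pX|apply: pY].
Qed.

End GlModule.

(* [GT_formulas] for an arbitrary family of vectors indexed by tableaux. *)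
Definition GT_action (R : realType) (n : nat) (T : tableau R n) (V : lmodType R[i])
    (t : tableau R n -> V) (rho : 'M[R[i]]_n -> V -> V) : Prop :=
  forall M, in_basis T M ->
  [/\ forall k k' : 'I_n, k' = k.+1 :> nat ->
        rho (delta_mx k k') (t M) =
        - \sum_(v | vrow v == k) coef_raise M v *: t (tab_add M v 1),
      forall k k' : 'I_n, k' = k.+1 :> nat ->
        rho (delta_mx k' k) (t M) =
        \sum_(v | vrow v == k) coef_lower M v *: t (tab_add M v (-1))
    & forall k : 'I_n, rho (delta_mx k k) (t M) = GT_weight M k *: t M].

Section Module.
Variables (R : realType) (n : nat) (T : tableau R n).
Local Notation G := (tableau_graph T).
Hypothesis (wfG : wf_graph G) (ncG : noncritical G) (realT : realization G T).
Variables (V : lmodType R[i]) (t : tableau R n -> V) (rho : 'M[R[i]]_n -> V -> V).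
Hypothesis (t_neq0 : forall M, in_basis T M -> t M != 0).
Hypothesis (t_notin : forall M, ~ in_basis T M -> t M = 0).
Hypothesis (glrho : gl_module rho) (GTrho : GT_action T t rho).
Local Notation act := (gl_act glrho).
Implicit Types (M N : tableau R n) (u v w : vertex n) (X Y : {linear V -> V}).

Definition shifts_row (X : V -> V) (k : 'I_n) (e : R[i])
    (a : tableau R n -> vertex n -> R[i]) : Prop :=
  forall M, in_basis T M -> X (t M) = \sum_(v | vrow v == k) a M v *: t (tab_add M v e).

Definition diagonal (X : V -> V) (h : tableau R n -> R[i]) : Prop :=
  forall M, in_basis T M -> X (t M) = h M *: t M.

Lemma act_raise (k k' : 'I_n) : k' = k.+1 :> nat ->
  shifts_row (act (delta_mx k k')) k 1 (fun M v => - coef_raise M v).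
Proof.
move=> kk M bM; have [raise _ _] := GTrho bM.
by rewrite /gl_act raise // -sumrN; apply: eq_bigr => v _; rewrite scaleNr.
Qed.

Lemma act_lower (k k' : 'I_n) : k' = k.+1 :> nat ->
  shifts_row (act (delta_mx k' k)) k (-1) (@coef_lower R n).
Proof. by move=> kk M bM; have [_ lower _] := GTrho bM; apply: lower. Qed.

Lemma act_weight (k : 'I_n) : diagonal (act (delta_mx k k)) (fun M => GT_weight M k).
Proof. by move=> M bM; have [_ _ weight] := GTrho bM; apply: weight. Qed.

Lemma shifts_row_comp X Y k e d a b M :
  shifts_row X k e a -> shifts_row Y k d b -> in_basis T M ->
  (forall v u, vrow v = k -> vrow u = k -> ~ in_basis T (tab_add M v e) ->
     (a M v * b (tab_add M v e) u) *: t (tab_add (tab_add M v e) u d) = 0) ->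
  Y (X (t M)) = \sum_(v | vrow v == k) \sum_(u | vrow u == k)
     (a M v * b (tab_add M v e) u) *: t (tab_add (tab_add M v e) u d).
Proof.
move=> shX shY bM vanish; rewrite shX // linear_sum; apply: eq_bigr => v /eqP vk.
rewrite linearZ /=; case: (pselect (in_basis T (tab_add M v e))) => [bN|notin].
  by rewrite shY // scaler_sumr; apply: eq_bigr => u _; rewrite scalerA.
rewrite t_notin // linear0 scaler0 big1 // => u /eqP uk.
exact: vanish.
Qed.

(* Off the diagonal the two products cancel by [coef_exchange]; paths through a
   tableau that is not a realization contribute [0]. *)
Lemma bracket_lower_diagonal X (phi : R[i] -> R[i]) (k k' : 'I_n) : k' = k.+1 :> nat ->
  shifts_row X k 1 (fun M u => - (phi (M u) * coef_raise M u)) ->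
  diagonal ((X \o act (delta_mx k' k)) \- (act (delta_mx k' k) \o X))
           (fun M => moment phi M k).
Proof.
move=> kk shX M bM; have shF := act_lower kk.
have nontop u : vrow u = k -> ~~ is_top u by move=> uk; rewrite /is_top uk -kk ltn_eqF.
rewrite /= (shifts_row_comp shF shX bM); last first.
  move=> v u vk uk notin; have [->|nuv] := eqVneq u v.
    rewrite (_ : _ * _ = - phi (tab_add M v (-1) v) * edge (tab_add M v (-1)) v).
      by rewrite (edge_lower_eq0 wfG realT bM (nontop v vk) notin) mulr0 scale0r.
    by rewrite /edge tab_addNK; ring.
  rewrite (t_notin (M := tab_add _ _ _)) ?scaler0 // => bN; apply: notin.
  rewrite eq_sym in nuv; apply: (in_basis_exchange wfG realT bM _ nuv _ _ bN).
  - by rewrite uk.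
  - exact: nontop.
  - exact: is_intN (is_int_nat _ 1).
rewrite (shifts_row_comp shX shF bM); last first.
  move=> u v uk vk notin; have [<-|nuv] := eqVneq u v.
    rewrite (_ : _ * _ = - phi (M u) * edge M u); last by rewrite /edge; ring.
    by rewrite (edge_raise_eq0 wfG realT bM (nontop u uk) notin) mulr0 scale0r.
  rewrite (t_notin (M := tab_add _ _ _)) ?scaler0 // => bN; apply: notin.
  apply: (in_basis_exchange wfG realT bM _ nuv (nontop u uk) _ bN); first by rewrite uk.
  exact: (is_int_nat _ 1).
rewrite [X in X - _]exchange_big /= -sumrB scaler_suml; apply: eq_bigr => u /eqP uk.
rewrite -sumrB (bigD1 u) ?uk //= tab_addK tab_addNK tab_add_eq.
rewrite big1 => [|v /andP[/eqP vk nvu]].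
  rewrite addr0 -scalerBl; apply: (congr1 (fun a => a *: t M)).
  by rewrite /edge tab_addNK; ring.
have nuv : u != v by rewrite eq_sym.
rewrite [tab_add (tab_add M u _) _ _]tab_addC -scalerBl tab_add_neq //.
rewrite mulrN mulrCA coef_exchange ?uk ?vk //.
  by rewrite mulNr opprK mulrA addNr scale0r.
by apply: (in_basis_row_neq wfG ncG bM _ (nontop u uk) nuv); rewrite uk vk.
Qed.

Lemma moment0_weight M (k k' : 'I_n) : k' = k.+1 :> nat -> in_basis T M ->
  moment (fun=> 1) M k = GT_weight M k - GT_weight M k'.
Proof.
move=> kk bM; apply: (scale_vector_inj (t_neq0 bM)).
have shE : shifts_row (act (delta_mx k k')) k 1 (fun M u => - (1 * coef_raise M u)).
  by move=> N bN; rewrite (act_raise kk bN); under [RHS]eq_bigr do rewrite mul1r.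
have /= <- := bracket_lower_diagonal (phi := fun=> 1) kk shE bM.
by rewrite -gl_act_bracket !mul_delta_mx gl_actB !act_weight // -scalerBl.
Qed.

(* [eigX] takes the values [eigX M + eigY M - M u] at the neighbours [M + delta^u],
   so it tells the vertices [u] of row [k] apart. *)
Definition row_separating (k : 'I_n) (eigX eigY : tableau R n -> R[i]) : Prop :=
  forall M u, vrow u = k -> in_basis T M -> in_basis T (tab_add M u 1) ->
    eigX (tab_add M u 1) = eigX M + eigY M - M u /\ eigY (tab_add M u 1) = eigY M + 1.

Lemma row_separating0 (k : 'I_n) : k = 0 :> nat ->
  row_separating k (fun=> 0) (fun M => GT_weight M k).
Proof.
move=> k0 M u uk _ _; rewrite -uk GT_weight_add GT_weight_row0 ?uk //.
by rewrite add0r subrr.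
Qed.

Lemma row_separatingS (k k' : 'I_n) : k' = k.+1 :> nat ->
  row_separating k' (fun M => moment id M k) (fun M => GT_weight M k' - GT_weight M k).
Proof.
move=> kk M w wk bM bN; have wk1 : vrow w = k.+1 :> nat by rewrite wk.
have kw : (k < vrow w)%N by rewrite wk1.
rewrite (GT_weight_add_above _ _ kw) -wk GT_weight_add; split; last by ring.
rewrite -[LHS](subrK (moment id M k)) moment_id_add //.
rewrite !(moment0_weight (k' := vrow w)) //.
by rewrite (GT_weight_add_above _ _ kw) GT_weight_add; ring.
Qed.

(* [E Y - [X, E]] acts as [E = E_{k,k+1}] with the summand moving the entry [M u]
   multiplied by [M u]. *)
Lemma shifts_row_weighted X Y eigX eigY (k k' : 'I_n) (E := act (delta_mx k k')) :
  k' = k.+1 :> nat -> diagonal X eigX -> diagonal Y eigY ->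
  row_separating k eigX eigY ->
  shifts_row ((E \o Y) \- ((X \o E) \- (E \o X))) k 1
             (fun M u => - (M u * coef_raise M u)).
Proof.
move=> kk dX dY sep M bM; have shE := act_raise kk.
rewrite /E /= dX // dY // !(linearZ_LR (act _)) /= shE // (linear_sum X) /=.
rewrite opprB addrA -scalerDl.
rewrite scaler_sumr -sumrB; apply: eq_bigr => u /eqP uk; rewrite (linearZ_LR X) /=.
case: (pselect (in_basis T (tab_add M u 1))) => [bN|notin].
  rewrite dX // !scalerA -scalerBl; congr (_ *: _).
  by have [-> _] := sep _ _ uk bM bN; ring.
by rewrite t_notin // (linear0 X) !scaler0 subr0.
Qed.

Lemma row_separating_ex (k : 'I_n) : exists X Y eigX eigY,
  [/\ preserving rho X, preserving rho Y, diagonal X eigX, diagonal Y eigY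
    & row_separating k eigX eigY].
Proof.
case: k => m; elim: m => [|m IH] lt_mn.
  exists \0, (act (delta_mx (Ordinal lt_mn) (Ordinal lt_mn))).
  exists (fun=> 0), (fun M => GT_weight M (Ordinal lt_mn)); split.
  - by move=> W [].
  - exact: preserving_act.
  - by move=> M _; rewrite scale0r.
  - exact: act_weight.
  - exact: row_separating0.
have [X [Y [eigX [eigY [pX pY dX dY sep]]]]] := IH (ltnW lt_mn).
set k := Ordinal (ltnW lt_mn) in sep; set k' := Ordinal lt_mn.
have kk : k' = k.+1 :> nat by [].
pose E := act (delta_mx k k'); pose F := act (delta_mx k' k).
pose E' : {linear V -> V} := (E \o Y) \- ((X \o E) \- (E \o X)).
have pE' : preserving rho E'.
  by do !apply: preserving_sub; apply: preserving_comp => //; apply: preserving_act.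
have shE' := shifts_row_weighted kk dX dY sep.
exists ((E' \o F) \- (F \o E')), (act (delta_mx k' k') \- act (delta_mx k k)).
exists (fun M => moment id M k), (fun M => GT_weight M k' - GT_weight M k); split.
- by apply: preserving_sub; apply: preserving_comp => //; apply: preserving_act.
- by apply: preserving_sub; apply: preserving_act.
- exact: (bracket_lower_diagonal (phi := id) kk shE').
- by move=> M bM /=; rewrite !act_weight // -scalerBl.
- exact: row_separatingS.
Qed.

Lemma submodule_shift (W : V -> Prop) X (theta : R[i] -> R[i]) M v e
    (a : vertex n -> R[i]) :
  submodule rho W -> preserving rho X -> injective theta -> in_basis T M ->
  ~~ is_top v ->
  (forall u, vrow u = vrow v -> in_basis T (tab_add M u e) ->
     X (t (tab_add M u e)) = theta (M u) *: t (tab_add M u e)) ->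
  a v != 0 -> W (\sum_(u | vrow u == vrow v) a u *: t (tab_add M u e)) ->
  W (t (tab_add M v e)).
Proof.
move=> sW pX inj bM tv eig nz; have [W0 W_lin _] := sW.
rewrite -big_enum => Wsum.
have in_row u : (u \in enum (fun u => vrow u == vrow v)) = (vrow u == vrow v).
  by rewrite mem_enum.
have Wv : W (a v *: t (tab_add M v e)).
  have := stable_subspace_eigen (eta := theta \o M) W0 W_lin (pX W sW)
    (enum_uniq _) _ _ Wsum.
  apply=> [u1 u2|u|]; rewrite ?in_row // => /eqP uv.
    move=> /eqP u2v /inj eqM; apply/eqP; apply: contra_eqT eqM => neq.
    by apply: (in_basis_row_neq wfG ncG bM _ _ neq); rewrite ?(eq_row_top uv) ?uv ?u2v.
  rewrite (linearZ_LR X) /= scalerA mulrC -scalerA.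
  case: (pselect (in_basis T (tab_add M u e))) => [/(eig u uv) -> //|notin].
  by rewrite t_notin // (linear0 X) !scaler0.
by rewrite -[t _](scalerK nz); apply: subspaceZ.
Qed.

Lemma submodule_raise (W : V -> Prop) M v : submodule rho W -> in_basis T M ->
  in_basis T (tab_add M v 1) -> W (t M) -> W (t (tab_add M v 1)).
Proof.
move=> sW bM bN WM; have tv := in_basis_add_nontop bM bN (oner_neq0 _).
have [X [_ [eigX [eigY [pX _ dX _ sep]]]]] := row_separating_ex (vrow v).
apply: (submodule_shift (theta := fun x => eigX M + eigY M - x)
  (a := fun u => - coef_raise M u) sW pX _ bM tv).
- by move=> x y /addrI/oppr_inj.
- by move=> u uv bMu; rewrite dX //; have [-> _] := sep _ _ uv bM bMu.
- by rewrite oppr_eq0; have := edge_neq0 wfG ncG bM bN; rewrite mulf_eq0 => /norP[].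
- by rewrite -(act_raise (k' := Ordinal (nontop_row tv))) //; apply: preserving_act.
Qed.

Lemma submodule_lower (W : V -> Prop) M v : submodule rho W -> in_basis T M ->
  in_basis T (tab_add M v (-1)) -> W (t M) -> W (t (tab_add M v (-1))).
Proof.
move=> sW bM bN WM; have tv : ~~ is_top v.
  by apply: in_basis_add_nontop bM bN _; rewrite oppr_eq0 oner_neq0.
have [X [_ [eigX [eigY [pX _ dX _ sep]]]]] := row_separating_ex (vrow v).
have bM' : in_basis T (tab_add (tab_add M v (-1)) v 1) by rewrite tab_addNK.
apply: (submodule_shift (theta := fun x => eigX M - eigY M + x)
  (a := coef_lower M) sW pX _ bM tv).
- by move=> x y /addrI.
- move=> u uv bMu; rewrite dX //; congr (_ *: _).
  have := sep _ _ uv bMu; rewrite tab_addNK => /(_ bM)[-> ->].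
  by rewrite tab_add_eq; ring.
- by have := edge_neq0 wfG ncG bN bM'; rewrite /edge tab_addNK mulf_eq0 => /norP[].
- by rewrite -(act_lower (k' := Ordinal (nontop_row tv))) //; apply: preserving_act.
Qed.

Lemma submodule_full (W : V -> Prop) M :
  submodule rho W -> W (t T) -> in_basis T M -> W (t M).
Proof.
move=> sW WT; apply: (in_basis_ind wfG realT (Q := fun M => W (t M))) => // N v bN bN'.
  exact: submodule_raise.
exact: submodule_lower.
Qed.

End Module.

Section TableauVectors.
Variables (R : realType) (n : nat) (T : tableau R n).
Local Notation G := (tableau_graph T).
Local Notation t := (tabvec G T).
Implicit Types (M : tableau R n).

Lemma tabvec_val (b : basis G T) : t (val b) = mkmalgU b 1.
Proof. by rewrite /tabvec valK. Qed.

Lemma in_basis_val (b : basis G T) : in_basis T (val b).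
Proof. exact/asboolP/(valP b). Qed.

Lemma in_basis_sub M : in_basis T M -> exists b : basis G T, val b = M.
Proof. by move=> /asboolP bM; exists (Sub M bM); rewrite SubK. Qed.

Lemma tabvec_notin M : ~ in_basis T M -> t M = 0.
Proof. by move=> notin; rewrite /tabvec insubN //; apply/asboolPn. Qed.

Lemma tabvec_neq0 M : in_basis T M -> t M != 0.
Proof.
move=> /in_basis_sub[b <-]; rewrite tabvec_val; apply/eqP => /(congr1 (mcoeff b)).
by rewrite mcoeffUU mcoeff0 => /eqP; rewrite oner_eq0.
Qed.

Lemma GT_formulas_action (rho : 'M[R[i]]_n -> VG G T -> VG G T) :
  GT_formulas rho -> GT_action T t rho.
Proof. by move=> GTrho M /in_basis_sub[b <-]; apply: GTrho. Qed.

Lemma tabvec_span (x : VG G T) : exists (r : seq (basis G T)) (a : basis G T -> R[i]),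
  x = \sum_(b <- r) a b *: t (val b).
Proof.
exists (msupp (x : {malg R[i][basis G T]})).
exists (fun b => mcoeff b (x : {malg R[i][basis G T]})).
rewrite {1}(monalgE (x : {malg R[i][basis G T]})); apply: eq_bigr => b _.
by rewrite tabvec_val; apply: mkmalgU_scale.
Qed.

End TableauVectors.

Section Columns.
Variables (n : nat) (A : zmodType).
Implicit Types (f : vertex n -> A) (c : 'I_n) (r : nat).

(* The entry of [f] in column [c] and row [r - 1], and [0] outside of the triangle. *)
Definition col_entry f c r : A := \sum_(v | ((vrow v).+1 == r) && (vcol v == c)) f v.

Lemma col_entryE f v c r : vcol v = c -> (vrow v).+1 = r -> col_entry f c r = f v.
Proof. by move=> <- <-; rewrite /col_entry (big_pred1 v). Qed.

Lemma col_entry_out f c r : (r <= c)%N -> col_entry f c r = 0.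
Proof.
move=> rc; rewrite /col_entry big_pred0 // => v; apply/andP => -[/eqP vr /eqP vc].
by have := valP v; rewrite -/(vrow v) -/(vcol v) vc leqNgt vr rc.
Qed.

Lemma sum_col_increment f c :
  \sum_(r < n) (col_entry f c r.+1 - col_entry f c r) = col_entry f c n.
Proof.
rewrite -(big_mkord predT (fun r => col_entry f c r.+1 - col_entry f c r)).
by rewrite telescope_sumr // [col_entry f c 0]col_entry_out ?subr0.
Qed.

Lemma sum_row_increment f (k : 'I_n) :
  \sum_(v | vrow v == k) f v - \sum_(v | (vrow v).+1 == k :> nat) f v =
  \sum_c (col_entry f c k.+1 - col_entry f c k).
Proof.
have sum_row r : \sum_(v | (vrow v).+1 == r) f v = \sum_c col_entry f c r.
  by rewrite (partition_big (@vcol n) predT).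
by rewrite sumrB -!sum_row; congr (_ - _); apply: eq_bigl => v; rewrite eqSS.
Qed.

Lemma vertex_above (v : vertex n) : ~~ is_top v ->
  exists2 u : vertex n, vcol u = vcol v & vrow u = (vrow v).+1 :> nat.
Proof.
move=> /nontop_row lt_vn; have vc : (vcol v <= Ordinal lt_vn)%N by apply: leqW (valP v).
by exists (exist _ (Ordinal lt_vn, vcol v) vc).
Qed.

Lemma vertex_top c : exists2 v : vertex n, vcol v = c & (vrow v).+1 = n.
Proof.
have n_gt0 : (0 < n)%N by apply: leq_ltn_trans (ltn_ord c).
have lt_n : (n.-1 < n)%N by rewrite prednK.
have cn : (c <= Ordinal lt_n)%N by rewrite /= -ltnS prednK.
by exists (exist _ (Ordinal lt_n, c) cn); rewrite //= prednK.
Qed.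

End Columns.

Lemma GT_weight_shift (R : realType) (n : nat) (T M : tableau R n)
    (z : vertex n -> int) (k : 'I_n) : (forall w, M w = T w + (z w)%:~R) ->
  GT_weight M k =
  GT_weight T k + (\sum_c (col_entry z c k.+1 - col_entry z c k))%:~R.
Proof.
move=> Mz; rewrite -sum_row_increment intrB !rmorph_sum /GT_weight.
by rewrite !(eq_bigr _ (fun v _ => Mz v)) !big_split /=; ring.
Qed.

Section Tsigma.
Variables (R : realType) (n : nat) (s : 'S_n) (X : 'rV[R[i]]_n).
Local Notation T := (Tsigma s X).
Local Notation si := (s^-1%g).
Implicit Types (u v : vertex n) (k r c : 'I_n).

Lemma Tsigma_step u v : vcol u = vcol v -> vrow u = (vrow v).+1 :> nat ->
  T v = T u + (si (vrow u) < si (vcol u))%N%:R.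
Proof.
move=> uc ur; have [down up] := Tsigma_rec s X uc ur.
have [inSigma roots] := GsigmaP s.
have := Sigma_arrow v u inSigma roots; have := Sigma_arrow u v inSigma roots.
rewrite uc ur !eqxx /= [_ == _.+2]ltn_eqF // orbF => arrow_uv arrow_vu.
have [goes_up|goes_down] := ltnP; first by rewrite up // arrow_vu.
rewrite addr0 down // arrow_uv ltn_neqAle goes_down andbT.
apply/eqP => /val_inj/perm_inj eq_cr.
by have := valP v; rewrite -/(vrow v) -/(vcol v) eq_cr ur ltnn.
Qed.

Lemma Tsigma_realization : realization (tableau_graph T) T.
Proof.
apply: tableau_graph_realization => v /vertex_above[u uc ur]; exists u => //.
rewrite (Tsigma_step uc ur) opprD addrA subrr sub0r.
exact/is_intN/is_int_nat.
Qed.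

Lemma Tsigma_col_increment r c : c != r ->
  col_entry T c r.+1 - col_entry T c r = - ((c < r)%N && (si r < si c)%N)%:R.
Proof.
move=> ncr; case: (ltngtP c r) => [cr|rc|/val_inj cr] /=; last first.
- by rewrite cr eqxx in ncr.
- by rewrite !col_entry_out ?(ltnW rc) // subrr mulr0n oppr0.
- have [u [v [ur uc vc uv]]] := vertex_pair cr.
  rewrite (col_entryE _ uc) ?ur // (col_entryE _ vc) -?uv ?ur //.
  by rewrite (Tsigma_step _ uv) ?uc ?vc // ur opprD addrA subrr sub0r.
Qed.

Lemma Tsigma_diagonal k : col_entry T k k.+1 =
  X 0 (si k) + \sum_(r | r != k) ((k < r)%N && (si r < si k)%N)%:R.
Proof.
have <- : col_entry T k n = X 0 (si k).
  have [v vk vn] := vertex_top k.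
  by rewrite (col_entryE _ vk vn) Tsigma_top ?vk // /is_top vn.
rewrite -sum_col_increment (bigD1 k) //= (col_entry_out _ (leqnn k)) subr0.
rewrite -addrA -big_split big1 /= ?addr0 // => r nrk.
by rewrite Tsigma_col_increment 1?eq_sym // addNr.
Qed.

Lemma GT_weight_Tsigma k : GT_weight T k = X 0 (si k) + (si k)%:R.
Proof.
have kE : k%:R = \sum_(c | c != k) (c < k)%N%:R :> R[i].
  by rewrite -[in LHS]sum_ord_ltn (bigD1 k) //= ltnn add0n natr_sum.
have sikE : (si k)%:R = \sum_(c | c != k) (si c < si k)%N%:R :> R[i].
  rewrite -[in LHS]sum_ord_ltn (reindex_inj (@perm_inj _ si)) (bigD1 k) //= ltnn add0n.
  by rewrite natr_sum.
rewrite /GT_weight -addrA sum_row_increment (bigD1 k) //=.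
rewrite (col_entry_out _ (leqnn k)) subr0.
rewrite Tsigma_diagonal kE sikE addrCA -addrA; congr (_ + _).
rewrite -!big_split /=; apply: eq_bigr => c nck; rewrite Tsigma_col_increment //.
have : si c != si k by rewrite (inj_eq perm_inj).
move: nck; rewrite -!val_eqE /=.
case: (ltngtP c k) => //= _ _; case: (ltngtP (si c) (si k)) => //= _ _;
  by rewrite !(mulr0n, mulr1n) ?(subrr, subr0, addr0, add0r).
Qed.

End Tsigma.

Section Dominance.
Variables (R : realType) (n : nat) (s : 'S_n) (X : 'rV[R[i]]_n).
Local Notation T := (Tsigma s X).
Local Notation si := (s^-1%g).
Hypothesis wfG : wf_graph (tableau_graph T).
Implicit Types (M : tableau R n) (z : vertex n -> int).

Lemma Tsigma_shift_monotone M z u v : in_basis T M ->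
  (forall w, M w = T w + (z w)%:~R) ->
  vcol u = vcol v -> vrow u = (vrow v).+1 :> nat ->
  0 <= ((si (vrow u))%:Z - (si (vcol u))%:Z) * (z u - z v).
Proof.
move=> bM Mz uc ur; have adj : adjacent u v by rewrite /adjacent ur eqxx.
have gapM x y : adjacent x y -> gap T x y = 0 -> 0 <= z x - z y.
  move=> xy tight; have /(in_basis_gap wfG bM) : arrow (pregraph T) x y.
    by apply: gap_pregraph => //; rewrite tight; exists 0%N.
  by rewrite (gap_shift _ _ Mz) tight add0r nonneg_intr.
have := Tsigma_step s X uc ur; case: ltnP => [goes_up|goes_down] /= step.
  have : 0 <= z v - z u; last by nia.
  by apply: gapM; rewrite 1?adjacent_sym // /gap ur leqnn step /=; ring.
have : 0 <= z u - z v; last by nia.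
by apply: gapM; rewrite // /gap ur ltnNge leqnSn step /=; ring.
Qed.

(* The weight of a basis tableau is that of [T] minus a nonnegative combination
   of the roots in [s (Delta^+)], tested here on the functional [e_k |-> s^-1 k].
   In each column the increments of [z] add up to [0], so [s^-1 k] may be
   replaced by [s^-1 k - s^-1 c]. *)
Lemma Tsigma_weight_dominates M (d : 'I_n -> int) : in_basis T M ->
  (forall k, GT_weight M k = GT_weight T k + (d k)%:~R) ->
  0 <= \sum_k (si k)%:Z * d k.
Proof.
move=> bM Md; have [z [z0 Mz]] := bM.2.
pose dz k c := col_entry z c k.+1 - col_entry z c k.
have dE k : d k = \sum_c dz k c.
  by apply/(@intr_inj R[i])/(addrI (GT_weight T k)); rewrite -Md (GT_weight_shift _ Mz).
have col0 (c : 'I_n) : \sum_(k < n) dz k c = 0.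
  by rewrite sum_col_increment /col_entry big1 // => v /andP[/z0 ->].
have -> : \sum_k (si k)%:Z * d k =
    \sum_(c < n) \sum_(k < n) ((si k)%:Z - (si c)%:Z) * dz k c.
  transitivity (\sum_(c < n) \sum_(k < n) (si k)%:Z * dz k c).
    by rewrite exchange_big /=; apply: eq_bigr => k _; rewrite dE mulr_sumr.
  apply: eq_bigr => c _; under [RHS]eq_bigr do rewrite mulrBl.
  by rewrite sumrB -mulr_sumr col0 mulr0 subr0.
apply: sumr_ge0 => c _; apply: sumr_ge0 => k _.
have [ck|kc|/val_inj ->] := ltngtP c k; last by rewrite subrr mul0r.
  have [u [v [ur uc vc uv]]] := vertex_pair ck.
  rewrite /dz (col_entryE _ uc) ?ur // (col_entryE _ vc) -?uv ?ur // -{1}ur -{1}uc.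
  exact: (Tsigma_shift_monotone bM Mz (etrans uc (esym vc)) uv).
by rewrite /dz !col_entry_out ?subrr ?mulr0 // ltnW.
Qed.

End Dominance.

Lemma highest_weight_vector_Tsigma (R : realType) (n : nat) (lam : 'rV[R[i]]_n)
    (s : 'S_n) (T := Tsigma s (lambda_bar lam)) (V : lmodType R[i])
    (t : tableau R n -> V) (rho : 'M[R[i]]_n -> V -> V) :
  wf_graph (tableau_graph T) -> t T != 0 -> gl_module rho -> GT_action T t rho ->
  (forall x, exists (r : seq (basis (tableau_graph T) T)) a,
     x = \sum_(b <- r) a b *: t (val b)) ->
  highest_weight_vector rho s lam (t T).
Proof.
move=> wfG nz glrho GTrho span.
have bT : in_basis T T := in_basis_refl (Tsigma_realization s (lambda_bar lam)).
have weight := act_weight glrho GTrho.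
split=> [|i|i j ij]; first exact/eqP.
  by rewrite [LHS]weight // GT_weight_Tsigma permK mxE subrK.
apply/eqP; apply: contraT => x_neq0.
have [r [a xE]] := span (rho (delta_mx (s i) (s j)) (t T)).
have [b wb] : exists b : basis (tableau_graph T) T, GT_weight (val b) =1
    fun k => GT_weight T k + ((k == s i)%:Z - (k == s j)%:Z)%:~R.
  apply: (@joint_eigenvalue R[i] V _ _ (fun k => gl_act glrho (delta_mx k k)) r
           (fun b => a b *: t (val b)) (fun b => GT_weight (val b))) => [k b|k|];
    rewrite -?xE //.
    by rewrite linearZ /= weight; [rewrite !scalerA mulrC|apply: in_basis_val].
  exact/gl_act_root/weight.
have := Tsigma_weight_dominates wfG (in_basis_val b) wb.
under eq_bigr do rewrite mulrBr; rewrite sumrB.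
rewrite (bigD1 (s i)) //= big1 => [|k /negbTE ->]; last by rewrite mulr0.
rewrite [X in _ - X](bigD1 (s j)) //= big1 => [|k /negbTE ->]; last by rewrite mulr0.
by rewrite !eqxx !permK !mulr1 !addr0; lia.
Qed.

Lemma tabvec_generates (R : realType) (n : nat) (T : tableau R n)
    (G := tableau_graph T) (rho : 'M[R[i]]_n -> VG G T -> VG G T) :
  wf_graph G -> noncritical G -> realization G T -> GT_module rho ->
  generated_by rho (tabvec G T T).
Proof.
move=> wfG ncG realT [glrho /GT_formulas_action GTrho] W sW WT x.
have [r [a ->]] := tabvec_span x; have [W0 W_lin _] := sW.
apply: subspace_sum => // b _; apply: subspaceZ => //.
exact: (submodule_full wfG ncG realT (@tabvec_neq0 _ _ T) (@tabvec_notin _ _ T)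
          glrho GTrho sW WT (in_basis_val b)).
Qed.

Theorem theorem4p14 (R : realType) (n : nat) (hn : (2 <= n)%N)
    (lam : 'rV[R[i]]_n) (s : 'S_n) :
  let T := Tsigma s (lambda_bar lam) in
  let G := tableau_graph T in
  relation_graph R G ->
  [/\ realization G T,
      exists rho : 'M[R[i]]_n -> VG G T -> VG G T, GT_module rho
    & forall rho : 'M[R[i]]_n -> VG G T -> VG G T, GT_module rho ->
        highest_weight_vector rho s lam (tabvec G T T)
        /\ highest_weight_module rho s lam].
Proof.
move=> T G [wfG ncG module_ex].
have realT : realization G T := Tsigma_realization s (lambda_bar lam).
split=> //; first exact: module_ex.
move=> rho GTmod; have [glrho /GT_formulas_action GTrho] := GTmod.
have hwv : highest_weight_vector rho s lam (tabvec G T T).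
  apply: (highest_weight_vector_Tsigma wfG _ glrho GTrho); last exact: tabvec_span.
  exact: tabvec_neq0 (in_basis_refl realT).
by split=> //; exists (tabvec G T T); split=> //; apply: tabvec_generates.
Qed.
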